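(* The super Krawtchouk polynomials $\mathcal{P}(\alpha,\epsilon,\tilde\alpha,\tilde\epsilon)=\mathcal{P}(\alpha,\epsilon,\tilde\alpha,\tilde\epsilon;\mathrm{K},\Lambda,D)$ arise, up to explicit scalars, as entries of the transition matrices between the $\mathfrak{h}$-weight basis $\{x^\alpha\xi^\epsilon\}$ and the $\tilde{\mathfrak{h}}$-weight basis $\{\tilde x^{\tilde\alpha}\tilde\xi^{\tilde\epsilon}\}$ of the $\mathfrak{g}$-module $\mathfrak{P}^D$. Specifically, for $x^\alpha\xi^\epsilon$ and $\tilde x^{\tilde\alpha}\tilde\xi^{\tilde\epsilon}$ in $\mathfrak{P}^D$ with $(\alpha,\epsilon),(\tilde\alpha,\tilde\epsilon)\in\mathbb{A}^{D-d,d}$, $$\tilde x^{\tilde\alpha}\tilde\xi^{\tilde\epsilon}=\tilde\theta^{D-d}\tilde\kappa^{d}\,D!\sum_{(\alpha,\epsilon)\in\mathbb{A}^{D-d,d}}\mathcal{P}(\alpha,\epsilon,\tilde\alpha,\tilde\epsilon)\,\frac{\tilde p^{\alpha}\tilde q^{\epsilon}}{\alpha!}\,x^{\alpha}\xi^{\epsilon},$$ $$x^{\alpha}\xi^{\epsilon}=\theta^{D-d}\kappa^{d}\,D!\sum_{(\tilde\alpha,\tilde\epsilon)\in\mathbb{A}^{D-d,d}}\mathcal{P}(\alpha,\epsilon,\tilde\alpha,\tilde\epsilon)\,\frac{p^{\tilde\alpha}q^{\tilde\epsilon}}{\tilde\alpha!}\,\tilde x^{\tilde\alpha}\tilde\x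i^{\tilde\epsilon}.$$
   Context: Let $m,n\in\mathbb{N}=\mathbb{Z}_{\ge0}$, $D\in\mathbb{N}$. Multi-index notation: $|\alpha|=\sum_i\alpha_i$, $\alpha!=\prod_i\alpha_i!$, $a^{\beta}=\prod_i a_i^{\beta_i}$. Data. $\mathrm{K}=(p,\tilde p,U)$ with $p,\tilde p\in\mathbb{C}^{m+1}$ and $U=(u_{i,j})_{i,j=0}^m$ a complex matrix such that $p_0=\tilde p_0\neq0$, $u_{0,j}=u_{i,0}=1$ for all $i,j$, and $PU\tilde PU^{\mathsf t}=p_0I_{m+1}$ with $P=\mathrm{diag}(p)$, $\tilde P=\mathrm{diag}(\tilde p)$. Likewise $\Lambda=(q,\tilde q,V)$ with $q,\tilde q\in\mathbb{C}^{n+1}$, $V=(v_{i,j})_{i,j=0}^n$ complex, $q_0=\tilde q_0\ne0$, $v_{0,j}=v_{i,0}=1$, and $QV\tilde QV^{\mathsf t}=q_0I_{n+1}$ with $Q=\mathrm{diag}(q)$, $\tilde Q=\mathrm{diag}(\tilde q)$. (Hence all $p_i,\tilde p_i,q_j,\tilde q_j$ are nonzero.) Variables. $x_0,\dots,x_m$ are commuting variables; $\xi_0,\dots,\xi_n$ are anticommuting (Grassmann) variables, $\xi_i\xi_j=-\xi_j\xi_i$, $\xi_j^2=0$, commuting with all $x_k$. Products $\xi^{\epsilon}=\xi_0^{\epsilon_0}\cdots\xi_n^{\epsilon_n}$, and all products of odd elements over an index $i$, are taken in increasing order of index. Put $\mathbb{Z}_2=\{0,1\}$, $\mathbb{A}^D=\{(\alpha,\epsilon)\in\mathbb{N}^{m+1}\times\mathbb{Z}_2^{n+1}:|\alpha|+|\epsilon|=D\}$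 and $\mathbb{A}^{D-d,d}=\{(\alpha,\epsilon)\in\mathbb{A}^D:|\epsilon|=d\}$. Super Krawtchouk polynomials. For $(\tilde\alpha,\tilde\epsilon)\in\mathbb{A}^D$ the $\mathcal{P}(\alpha,\epsilon,\tilde\alpha,\tilde\epsilon)$ are defined by $$\prod_{i=0}^m\Big(\sum_{j=0}^m u_{i,j}x_j\Big)^{\tilde\alpha_i}\prod_{i=0}^n\Big(\sum_{j=0}^n v_{i,j}\xi_j\Big)^{\tilde\epsilon_i}=\sum_{(\alpha,\epsilon)\in\mathbb{A}^D}\frac{D!}{\alpha!}\,\mathcal{P}(\alpha,\epsilon,\tilde\alpha,\tilde\epsilon)\,x^\alpha\xi^\epsilon .$$ Module and bases. $\mathfrak{g}=\mathfrak{gl}(m+1|n+1)$ acts on $\mathfrak{P}=\mathbb{C}[x_0,\dots,x_m]\otimes\bigwedge[\xi_0,\dots,\xi_n]$ by $E_{i,j}\mapsto w_i\partial_{w_j}$, where $w_i=x_i$ ($0\le i\le m$), $w_{m+1+j}=\xi_j$ ($0\le j\le n$) and the derivatives are left superderivations. $\mathfrak{P}^D$ is the span of $x^\alpha\xi^\epsilon$, $(\alpha,\epsilon)\in\mathbb{A}^D$. Choose $\tilde\theta,\tilde\kappa\in\mathbb{C}$ such that $R=\tilde\theta\tilde PU^{\mathsf t}$ and $S=\tilde\kappa\tilde QV^{\mathsf t}$ have determinant $1$; put $\theta=(p_0\tilde\theta)^{-1}$, $\kappa=(q_0\tilde\kappa)^{-1}$. $\mathfrak{h}$ is spanned by the $E_{i,i}$,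 and $\tilde{\mathfrak h}$ by the $\tilde E_{i,i}$, where $\tilde X=\mathrm{diag}(R,S)\,X\,\mathrm{diag}(R^{-1},S^{-1})$. Finally $\tilde x_i=\tilde\theta\sum_{k=0}^m\tilde p_ku_{i,k}x_k$ and $\tilde\xi_j=\tilde\kappa\sum_{k=0}^n\tilde q_kv_{j,k}\xi_k$. *)

(* Defs.v *)
From HB Require Import structures.
From mathcomp Require Import all_boot all_order all_algebra.
From mathcomp Require Import mpoly complex.
From mathcomp Require Import reals ring.

Set Implicit Arguments.
Unset Strict Implicit.
Unset Printing Implicit Defensive.

Import GRing.Theory.
Local Open Scope ring_scope.

Section Exterior.
Variables (A : comNzRingType) (n : nat).
Implicit Types (S T : {set 'I_n}).

(* An element of the exterior algebra over A on xi_0, ..., xi_(n-1) is the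
   family of its coefficients on the products xi_S of the xi_j, j in S, taken
   in increasing order of j. *)
Definition exterior := {ffun {set 'I_n} -> A}.

HB.instance Definition _ := GRing.Zmodule.on exterior.

Definition inversions S T : nat := (\sum_(i in S) \sum_(j in T) (j < i))%N.

(* For disjoint S and T, xi_S * xi_T = (-1) ^+ inversions S T * xi_(S :|: T). *)
Definition ext_mul (f g : exterior) : exterior :=
  [ffun S : {set 'I_n} => \sum_(T : {set 'I_n} | T \subset S)
     (-1) ^+ inversions T (S :\: T) * (f T * g (S :\: T))].

Definition ext_one : exterior := [ffun S => (S == set0)%:R].

Lemma inversionsUl S T Z : T \subset S ->
  inversions S Z = (inversions T Z + inversions (S :\: T) Z)%N.
Proof.
by move=> sTS; rewrite /inversions (big_setID T) /= (setIidPr sTS).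
Qed.

Lemma inversionsUr S T Z : T \subset S ->
  inversions Z S = (inversions Z T + inversions Z (S :\: T))%N.
Proof.
move=> sTS; rewrite /inversions -big_split; apply: eq_bigr => i _.
by rewrite (big_setID T) /= (setIidPr sTS).
Qed.

Lemma inversions0l S : inversions set0 S = 0%N.
Proof. by rewrite /inversions big_set0. Qed.

Lemma inversions0r S : inversions S set0 = 0%N.
Proof. by rewrite /inversions big1 // => i _; rewrite big_set0. Qed.

Lemma ext_mulA : associative ext_mul.
Proof.
move=> f g h; apply/ffunP => S; rewrite !ffunE.
transitivity (\sum_(T : {set 'I_n} | T \subset S)
   \sum_(Z : {set 'I_n} | Z \subset S :\: T)
    (-1) ^+ inversions T (S :\: T) *
     (f T * ((-1) ^+ inversions Z (S :\: T :\: Z)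
        * (g Z * h (S :\: T :\: Z))))).
  by apply: eq_bigr => T _; rewrite ffunE !mulr_sumr.
transitivity (\sum_(C : {set 'I_n} | C \subset S)
   \sum_(T : {set 'I_n} | T \subset C)
    (-1) ^+ inversions C (S :\: C) *
     (((-1) ^+ inversions T (C :\: T) * (f T * g (C :\: T)))
        * h (S :\: C))); last first.
  by apply: eq_bigr => T _; rewrite ffunE mulr_suml mulr_sumr.
rewrite [RHS](exchange_big_dep (fun T : {set 'I_n} => T \subset S)) /=; last first.
  by move=> C T sCS sTC; apply: subset_trans sTC sCS.
apply: eq_bigr => T sTS.
rewrite [RHS](reindex_onto (fun Z => T :|: Z) (fun C => C :\: T)) /=; last first.
  move=> C /andP[_ sTC]; apply/setP => x; rewrite !inE.
  by have [/(subsetP sTC)->|] := boolP (x \in T).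
have dTP (Z : {set 'I_n}) :
    [&& T :|: Z \subset S, T \subset T :|: Z & (T :|: Z) :\: T == Z]
    = (Z \subset S :\: T).
  rewrite subUset sTS subsetUl /= setDUl setDv set0U subsetD; congr (_ && _).
  by apply/eqP/idP => /setDidPl.
apply: eq_big => [Z|Z sZ]; first by rewrite -dTP -andbA.
have := sZ; rewrite -dTP => /and3P[sTZS _ /eqP TZD].
rewrite TZD setDDl (inversionsUr _ sZ) setDDl.
rewrite (inversionsUl (S := T :|: Z) (T := T)) ?subsetUl // TZD.
by rewrite !exprD; ring.
Qed.

Lemma ext_mul1l : left_id ext_one ext_mul.
Proof.
move=> f; apply/ffunP => S; rewrite ffunE (bigD1 set0) ?sub0set //= ffunE eqxx.
rewrite setD0 inversions0l mul1r mul1r big1 ?addr0 // => T /andP[_ /negPf T0].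
by rewrite ffunE T0 mul0r mulr0.
Qed.

Lemma ext_mul1r : right_id ext_one ext_mul.
Proof.
move=> f; apply/ffunP => S; rewrite ffunE (bigD1 S) //= ffunE setDv eqxx.
rewrite inversions0r mul1r mulr1 big1 ?addr0 // => T /andP[sTS nTS].
rewrite ffunE setD_eq0 (_ : (S \subset T) = false) ?mulr0 //.
by apply: contraNF nTS => sST; rewrite eqEsubset sTS.
Qed.

Lemma ext_mulDl : left_distributive ext_mul +%R.
Proof.
move=> f g h; apply/ffunP => S; rewrite !ffunE -big_split /=.
by apply: eq_bigr => T _; rewrite ffunE mulrDl mulrDr.
Qed.

Lemma ext_mulDr : right_distributive ext_mul +%R.
Proof.
move=> f g h; apply/ffunP => S; rewrite !ffunE -big_split /=.
by apply: eq_bigr => T _; rewrite ffunE !mulrDr.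
Qed.

Lemma ext_one_neq0 : ext_one != 0.
Proof.
apply/eqP => /ffunP/(_ set0); rewrite !ffunE eqxx => /eqP.
by rewrite oner_eq0.
Qed.

HB.instance Definition _ := GRing.Zmodule_isNzRing.Build exterior
  ext_mulA ext_mul1l ext_mul1r ext_mulDl ext_mulDr ext_one_neq0.

Definition ext_mon (a : A) S : exterior := [ffun T => if T == S then a else 0].
End Exterior.

(* K[x_0, ..., x_(m-1)] tensored with the exterior algebra on
   xi_0, ..., xi_(n-1). *)
Definition superpoly (K : fieldType) (m n : nat) := exterior {mpoly K[m]} n.

HB.instance Definition _ (K : fieldType) m n :=
  GRing.NzRing.on (superpoly K m n).
HB.instance Definition _ (K : fieldType) m n :=
  GRing.Zmodule_isLmodule.Build K (superpoly K m n)
    (@scalerA K {ffun {set 'I_n} -> {mpoly K[m]}})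
    (@scale1r K {ffun {set 'I_n} -> {mpoly K[m]}})
    (@scalerDr K {ffun {set 'I_n} -> {mpoly K[m]}})
    (fun v => @scalerDl K {ffun {set 'I_n} -> {mpoly K[m]}} v).
Fact superpoly_scalerAl (K : fieldType) m n (c : K) (f g : superpoly K m n) :
  c *: (f * g) = (c *: f) * g.
Proof.
apply/ffunP => S; rewrite !ffunE scaler_sumr; apply: eq_bigr => T _.
by rewrite ffunE scalerAr -scalerAl.
Qed.
HB.instance Definition _ (K : fieldType) m n :=
  GRing.Lmodule_isLalgebra.Build K (superpoly K m n)
    (@superpoly_scalerAl K m n).
Fact superpoly_scalerAr (K : fieldType) m n (c : K) (f g : superpoly K m n) :
  c *: (f * g) = f * (c *: g).
Proof.
apply/ffunP => S; rewrite !ffunE scaler_sumr; apply: eq_bigr => T _.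
by rewrite ffunE !scalerAr.
Qed.
HB.instance Definition _ (K : fieldType) m n :=
  GRing.Lalgebra_isAlgebra.Build K (superpoly K m n)
    (@superpoly_scalerAr K m n).

Section SuperPolynomials.
Variables (K : fieldType) (m n : nat).
Implicit Types (f g : superpoly K m n) (X Y : 'M[K]_(m + n)).

Definition evar (i : 'I_m) : superpoly K m n := ext_mon 'X_i set0.
Definition ovar (j : 'I_n) : superpoly K m n := ext_mon 1 [set j].

Definition ederiv (i : 'I_m) f : superpoly K m n := [ffun S => (f S)^`M(i)].

(* The left superderivation with xi_j |-> 1: for j not in S it sends
   xi_(j |: S) = (-1) ^+ #{k in S | k < j} * xi_j * xi_S
   to (-1) ^+ #{k in S | k < j} * xi_S. *)
Definition oderiv (j : 'I_n) f : superpoly K m n :=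
  [ffun S : {set 'I_n} => if j \in S then 0
             else (-1) ^+ inversions [set j] S * f (j |: S)].

Definition svar (i : 'I_(m + n)) : superpoly K m n :=
  match split i with inl k => evar k | inr k => ovar k end.
Definition sderiv (i : 'I_(m + n)) f : superpoly K m n :=
  match split i with inl k => ederiv k f | inr k => oderiv k f end.

Definition gl_act X f : superpoly K m n :=
  \sum_i \sum_j X i j *: (svar i * sderiv j f).

Definition idx_odd (i : 'I_(m + n)) : bool := (m <= i)%N.

Definition gl_parity (b : bool) X : Prop :=
  forall i j, X i j != 0 -> idx_odd i (+) idx_odd j = b.

(* The bracket of gl(m|n) on X of parity a and Y of parity b. *)
Definition superbracket (a b : bool) X Y : 'M[K]_(m + n) :=
  X *m Y - (-1) ^+ (a && b) *: (Y *m X).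

Definition gl_module (W : superpoly K m n -> Prop) : Prop :=
  (forall X f, W f -> W (gl_act X f)) /\
  (forall a b X Y, gl_parity a X -> gl_parity b Y -> forall f, W f ->
     gl_act (superbracket a b X Y) f =
     gl_act X (gl_act Y f) - (-1) ^+ (a && b) *: gl_act Y (gl_act X f)).

Definition is_basis (T : finType) (W : superpoly K m n -> Prop) (I : {set T})
    (b : T -> superpoly K m n) : Prop :=
  [/\ forall t, t \in I -> W (b t),
      forall f, W f -> exists c : T -> K, f = \sum_(t in I) c t *: b t &
      forall c : T -> K, \sum_(t in I) c t *: b t = 0 ->
        forall t, t \in I -> c t = 0].

Definition weight_vector (H : {vspace 'M[K]_(m + n)}) f : Prop :=
  f != 0 /\ exists lam : {scalar 'M[K]_(m + n)},
    forall X, X \in H -> gl_act X f = lam X *: f.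

Definition weight_basis (T : finType) (H : {vspace 'M[K]_(m + n)})
    (W : superpoly K m n -> Prop) (I : {set T})
    (b : T -> superpoly K m n) : Prop :=
  is_basis W I b /\ forall t, t \in I -> weight_vector H (b t).

Definition cartan : {vspace 'M[K]_(m + n)} :=
  <<[seq delta_mx i i | i <- enum 'I_(m + n)]>>%VS.

Definition gl_conj (R : 'M[K]_m) (S : 'M[K]_n) X : 'M[K]_(m + n) :=
  block_mx R 0 0 S *m X *m block_mx (invmx R) 0 0 (invmx S).

Definition tcartan (R : 'M[K]_m) (S : 'M[K]_n) : {vspace 'M[K]_(m + n)} :=
  <<[seq gl_conj R S (delta_mx i i) | i <- enum 'I_(m + n)]>>%VS.

End SuperPolynomials.

Arguments evar {K m n} i.
Arguments ovar {K m n} j.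
Arguments cartan {K m n}.

(* Pairs (alpha, epsilon), where epsilon in {0,1}^n is encoded by its support.
   The bound D.+1 only makes the type of alpha finite: all the pairs of
   interest satisfy |alpha| + |epsilon| = D. *)
Definition sidx (m n D : nat) :=
  ('X_{1..m < D.+1} * {set 'I_n})%type.

Definition AD (m n D : nat) : {set sidx m n D} :=
  [set t : sidx m n D | mdeg t.1 + #|t.2| == D]%N.

Definition ADd (m n D d : nat) : {set sidx m n D} :=
  [set t in AD m n D | #|t.2| == d].

Definition mfact (m : nat) (a : 'X_{1..m}) : nat := (\prod_i (a i)`!)%N.

(* X ^ alpha * Y ^ epsilon; both products are in increasing order of index. *)
Definition smonom (A : nzRingType) (m n D : nat) (X : 'I_m -> A)
    (Y : 'I_n -> A) (t : sidx m n D) : A :=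
  (\prod_(i < m) X i ^+ t.1 i) * \prod_(j < n) Y j ^+ (j \in t.2).

Definition xmonom (K : fieldType) (m n D : nat) (t : sidx m n D) :
    superpoly K m n := smonom evar ovar t.

Definition homog_part (K : fieldType) (m n D : nat) (f : superpoly K m n) :
    Prop :=
  exists c : sidx m n D -> K, f = \sum_(t in AD m n D) c t *: xmonom K t.

Definition krawtchouk_data (K : fieldType) (m : nat) (p pt : 'rV[K]_m.+1)
    (U : 'M[K]_m.+1) : Prop :=
  [/\ p 0 0 = pt 0 0, p 0 0 != 0, forall j, U 0 j = 1, forall i, U i 0 = 1 &
      diag_mx p *m U *m diag_mx pt *m U^T = (p 0 0)%:M].

Section SuperKrawtchouk.
Variables (K : fieldType) (m n D : nat) (U : 'M[K]_m) (V : 'M[K]_n).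

Definition krawtchouk_gen (t : sidx m n D) : superpoly K m n :=
  smonom (fun i => \sum_j U i j *: evar j) (fun i => \sum_j V i j *: ovar j) t.

(* The coefficient of x^alpha xi^epsilon in krawtchouk_gen t', times
   alpha! / D!; see krawtchouk_genE. *)
Definition super_krawtchouk (t t' : sidx m n D) : K :=
  (mfact t.1)%:R / (D`!)%:R * (krawtchouk_gen t' t.2)@_(t.1).

End SuperKrawtchouk.

Section GeneratingFunction.
Variables (K : numFieldType) (m n : nat).
Implicit Types (f g : superpoly K m n).

Lemma ext_monMl (a : {mpoly K[m]}) f S :
  ((ext_mon a set0 : superpoly K m n) * f) S = a * f S.
Proof.
rewrite ffunE (bigD1 set0) ?sub0set //= ffunE eqxx setD0 inversions0l mul1r.
by rewrite big1 ?addr0 // => T /andP[_ /negPf T0]; rewrite ffunE T0 mul0r mulr0.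
Qed.

Lemma prod_evar (a : 'X_{1..m}) :
  \prod_(i < m) (evar i : superpoly K m n) ^+ a i = ext_mon 'X_[a] set0.
Proof.
have M (b c : {mpoly K[m]}) :
    (ext_mon b set0 : superpoly K m n) * ext_mon c set0 = ext_mon (b * c) set0.
  by apply/ffunP => S; rewrite ext_monMl !ffunE; case: eqP; rewrite ?mulr0.
have E1 : (1 : superpoly K m n) = ext_mon 1 set0.
  by apply/ffunP => S; rewrite !ffunE; case: eqP.
rewrite mpolyXE_id; elim/big_rec2: _ => [|i b c _ ->]; first by rewrite E1.
rewrite -M; congr (_ * _); elim: (a i) => [|k IHk]; first by rewrite !expr0 E1.
by rewrite !exprS IHk M.
Qed.

Lemma ovarM (j : 'I_n) (T : {set 'I_n}) : (forall k, k \in T -> (j < k)%N) ->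
  (ovar j : superpoly K m n) * ext_mon 1 T = ext_mon 1 (j |: T).
Proof.
move=> jT; have jNT : j \notin T by apply/negP => /jT; rewrite ltnn.
apply/ffunP => S; rewrite !ffunE.
have [jS|jNS] := boolP (j \in S); last first.
  rewrite big1 => [|Z sZS].
    by case: eqP => // SE; rewrite SE setU11 in jNS.
  rewrite ffunE; case: eqP => [ZE|]; last by rewrite mul0r mulr0.
  by rewrite ZE sub1set (negPf jNS) in sZS.
rewrite (bigD1 [set j]) ?sub1set //= [X in _ + X]big1 ?addr0; last first.
  by move=> Z /andP[_ /negPf Zj]; rewrite ffunE Zj mul0r mulr0.
rewrite !ffunE eqxx mul1r (_ : (S == j |: T) = (S :\ j == T)); last first.
  apply/eqP/eqP => [->|<-]; last by rewrite setD1K.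
  by rewrite setU1K.
case: eqP => [->|_]; last by rewrite mulr0.
rewrite /inversions big_set1 big1 ?mulr1 // => k /jT jk.
by rewrite ltnNge ltnW.
Qed.

Lemma prod_ovar (e : {set 'I_n}) :
  \prod_(j < n) (ovar j : superpoly K m n) ^+ (j \in e) = ext_mon 1 e.
Proof.
have {2}->: e = [set j in enum 'I_n | j \in e].
  by apply/setP => j; rewrite inE mem_enum.
have -> (F : 'I_n -> superpoly K m n) : \prod_(j < n) F j = \prod_(j <- enum 'I_n) F j.
  by rewrite -[RHS]big_filter filter_predT -[LHS]big_filter [X in _ = \big[_/_]_(_ <- X) _]enumT filter_predT.
have : sorted (fun i j : 'I_n => (i < j)%N) (enum 'I_n).
  by rewrite -(@sorted_map _ _ val ltn) val_enum_ord iota_ltn_sorted.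
elim: (enum 'I_n) => [_|j r IHr] /=.
  rewrite big_nil; apply/ffunP => S; rewrite !ffunE.
  rewrite (_ : [set _ | _] = set0); first by case: eqP.
  by apply/setP => j; rewrite !inE.
rewrite path_sortedE; last by move=> x y z; apply: ltn_trans.
case/andP=> /allP jr /IHr{IHr}; rewrite big_cons => ->.
have [je|/negPf je] := boolP (j \in e).
  rewrite expr1 ovarM => [|k]; last by rewrite inE => /andP[/jr].
  congr ext_mon; apply/setP => k; rewrite !inE.
  by case: eqP => [->|].
rewrite expr0 mul1r; congr ext_mon; apply/setP => k; rewrite !inE.
by case: eqP => [->|]; rewrite // je !andbF.
Qed.

Lemma xmonomE D (t : sidx m n D) : xmonom K t = ext_mon 'X_[t.1] t.2.
Proof.
rewrite /xmonom /smonom prod_evar prod_ovar; apply/ffunP => S.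
by rewrite ext_monMl !ffunE; case: eqP; rewrite ?mulr1 ?mulr0.
Qed.

(* Total degree d in the x_i and the xi_j. *)
Definition graded (d : nat) f : Prop :=
  forall (S : {set 'I_n}) (a : 'X_{1..m}),
    (mdeg a + #|S|)%N != d -> (f S)@_a = 0.

Lemma gradedM d e f g : graded d f -> graded e g -> graded (d + e) (f * g).
Proof.
move=> hf hg S a; rewrite ffunE raddf_sum => hd; apply: big1 => T sTS /=.
rewrite -signr_odd; suff h0 : (f T * g (S :\: T))@_a = 0.
  by case: (odd _); rewrite ?expr1 ?mulN1r ?mcoeffN ?expr0 ?mul1r h0 ?oppr0.
rewrite mcoeffM; apply: big1 => -[b c] /= /eqP aE.
have [/eqP bE|bE] := boolP (mdeg b + #|T| == d)%N; last by rewrite hf ?mul0r.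
rewrite [X in _ * X]hg ?mulr0 //; apply: contraNneq hd => cE.
rewrite aE mdegD -bE -cE -(cardsID T S) (setIidPr sTS).
by rewrite addnACA.
Qed.

Lemma graded1 : graded 0 (1 : superpoly K m n).
Proof.
move=> S a hd; rewrite ffunE; case: (S =P _) hd => [->|_ _]; last by rewrite mcoeff0.
by rewrite cards0 addn0 mdeg_eq0 mcoeff1 => /negPf->.
Qed.

Lemma gradedX d f k : graded d f -> graded (k * d) (f ^+ k).
Proof.
move=> hf; elim: k => [|k IHk]; first exact: graded1.
by rewrite exprS mulSn; apply: gradedM.
Qed.

Lemma graded_sum (I : finType) (c : I -> K) (F : I -> superpoly K m n) d :
  (forall i, graded d (F i)) -> graded d (\sum_i c i *: F i).
Proof.
move=> hF S a hd; elim/big_rec: _ => [|i f _ IH].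
  by rewrite ffunE mcoeff0.
by rewrite ffunE mcoeffD IH ffunE mcoeffZ hF ?mulr0 ?addr0.
Qed.

Lemma graded_prod (k : nat) (F : 'I_k -> superpoly K m n) (d : 'I_k -> nat) :
  (forall i, graded 1 (F i)) ->
  graded (\sum_i d i)%N (\prod_(i < k) F i ^+ d i).
Proof.
move=> hF; elim/big_rec2: _ => [|i e f _ hf]; first exact: graded1.
by apply: gradedM => //; have := @gradedX _ _ (d i) (hF i); rewrite muln1.
Qed.

Lemma graded_evar (i : 'I_m) : graded 1 (evar i : superpoly K m n).
Proof.
move=> S a hd; rewrite ffunE; case: (S =P _) hd => [->|_ _]; last by rewrite mcoeff0.
rewrite cards0 addn0 mcoeffX; case: (_ =P a) => // <-.
by rewrite mdeg1 eqxx.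
Qed.

Lemma graded_ovar (j : 'I_n) : graded 1 (ovar j : superpoly K m n).
Proof.
move=> S a hd; rewrite ffunE; case: (S =P _) hd => [->|_ _]; last by rewrite mcoeff0.
rewrite cards1 addn1 mcoeff1; case: (a =P _) => // ->.
by rewrite mdeg0 eqxx.
Qed.

Lemma krawtchouk_genE D (U : 'M[K]_m) (V : 'M[K]_n) (t' : sidx m n D) :
  t' \in AD m n D ->
  krawtchouk_gen U V t' =
    \sum_(t in AD m n D)
      (D`!%:R / (mfact t.1)%:R * super_krawtchouk U V t t') *: xmonom K t.
Proof.
rewrite inE => /eqP tD.
have hG : graded D (krawtchouk_gen U V t').
  suff : graded (mdeg t'.1 + #|t'.2|) (krawtchouk_gen U V t') by rewrite tD.
  have -> : #|t'.2| = (\sum_(j < n) (j \in t'.2))%N.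
    by rewrite -sum1_card big_mkcond; apply: eq_bigr => j _; case: (j \in _).
  rewrite mdegE; apply: gradedM.
    by apply: graded_prod => i; apply: graded_sum => j; apply: graded_evar.
  by apply: graded_prod => i; apply: graded_sum => j; apply: graded_ovar.
have fact0 (k : nat) : (0 < k)%N -> k%:R != 0 :> K by rewrite Num.Theory.pnatr_eq0 -lt0n.
have cE (t : sidx m n D) :
  D`!%:R / (mfact t.1)%:R * super_krawtchouk U V t t' = (krawtchouk_gen U V t' t.2)@_(t.1).
  have D0 : D`!%:R != 0 :> K by rewrite fact0 ?fact_gt0.
  have a0 : (mfact t.1)%:R != 0 :> K.
    by rewrite fact0 // /mfact prodn_gt0 // => i; rewrite fact_gt0.
  by rewrite /super_krawtchouk; field; rewrite D0 a0.
under eq_bigr => t _ do rewrite cE xmonomE.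
move: (krawtchouk_gen U V t') hG {cE} => G hG.
apply/ffunP => S; apply/mpolyP => a; rewrite sum_ffunE raddf_sum /=.
under eq_bigr => t _ do rewrite !ffunE mcoeffZ.
have [aD|aD] := eqVneq (mdeg a + #|S|)%N D; last first.
  rewrite hG // big1 // => t; rewrite inE => /eqP tE.
  case: (S =P t.2) => [SE|_]; last by rewrite mcoeff0 mulr0.
  rewrite mcoeffX; case: eqP => [aE|_]; last by rewrite mulr0.
  by rewrite -aE SE tE eqxx in aD.
have aB : (mdeg a < D.+1)%N by rewrite ltnS -aD leq_addr.
pose t0 : sidx m n D := (BMultinom aB, S).
rewrite (bigD1 t0); last by rewrite inE /= aD.
rewrite /= eqxx mcoeffX eqxx mulr1 big1 => [|t /andP[_ nt]].
  by rewrite addr0.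
case: (S =P t.2) => [SE|_]; last by rewrite mcoeff0 mulr0.
rewrite mcoeffX; case: eqP => [aE|_]; last by rewrite mulr0.
case/eqP: nt; rewrite /t0 SE; case: t aE {SE} => b T /= aE; congr (_, _).
exact: val_inj.
Qed.
End GeneratingFunction.

(* The products tilde x ^ alpha * tilde xi ^ epsilon. *)
Definition txmonom (K : fieldType) (m n D : nat) (pt : 'rV[K]_m) (U : 'M[K]_m)
    (qt : 'rV[K]_n) (V : 'M[K]_n) (thetat kappat : K) (t : sidx m n D) :
    superpoly K m n :=
  smonom (fun i => thetat *: \sum_k (pt 0 k * U i k) *: evar k)
         (fun j => kappat *: \sum_k (qt 0 k * V j k) *: ovar k) t.

(* Main.v *)
Require Import Defs.
From HB Require Import structures.
From mathcomp Require Import all_boot all_order all_algebra.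
From mathcomp Require Import mpoly complex.
From mathcomp Require Import reals ring.

Set Implicit Arguments.
Unset Strict Implicit.
Unset Printing Implicit Defensive.

Import GRing.Theory.
Local Open Scope ring_scope.

(** The superpolynomials form the Fock module of a Weyl-Clifford algebra: the
    multiplications by the variables w_k and the derivatives d_k satisfy the
    super-commutation relations, the d_k kill 1, and the products of variables
    applied to 1 span. The main facts follow from these relations by induction
    on words in the w_k ([fock_ind]). The first is that X in gl(m|n) acts by a
    superderivation, so that the bracket relations need only be compared on the
    variables ([glact_bracket]).

    A block-diagonal matrix G = diag(R, S) acts by the substitution
    w_k |-> sum_i G_ik w_i ([lsubst R S]). Substitutions compose like matrices,
    obey the chain rule d_j phi_G = sum_l G_jl phi_G d_l ([derv_subst]), and
    hence conjugate the action of X in gl(m|n) into that of G X G^-1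
    ([glact_conj]). The products of the tilde variables are the images of the
    monomials under the substitution G = diag(thetat Pt U^T, kappat Qt V^T).
    As the monomials are weight vectors for the diagonal matrices, their images
    are weight vectors for the conjugated Cartan subalgebra, and they form a
    basis because G is invertible ([lsubst_weight_basis]).

    The polynomial that generates the values P(t, t') is the image of the
    monomial t' under diag(U^T, V^T). Composing with a diagonal substitution,
    which only rescales monomials, yields the first expansion
    ([lsubst_krawtchouk]). For the second one, P U Pt U^T = p_0 and
    Q V Qt V^T = q_0 say that the inverse of G is diag(theta P U, kappa Q V),
    which has the same shape with U^T and V^T in place of U and V. So the second expansion is the first one for the
    transposed matrices, with coefficients P(t', t; U^T, V^T), and what remains
    is the symmetry P(t', t; U^T, V^T) = P(t, t'; U, V)
    ([super_krawtchouk_tr]).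

    That symmetry comes from the pairing for which distinct monomials are
    orthogonal and x^a xi^S has square a!. Up to the factor D!, P(t, t') is a
    matrix entry of a substitution for this pairing; multiplication by w_k is
    adjoint to d_k, so by the chain rule the substitution G is adjoint to the
    substitution G^T ([pairing_subst]). *)

(** * Fock modules *)

Section Koszul.
Variable K : pzRingType.
Implicit Types a b c : bool.

Definition koszul a b : K := (-1) ^+ (a && b).

Lemma koszulC a b : koszul a b = koszul b a.
Proof. by rewrite /koszul andbC. Qed.

Lemma koszulDl a b c : koszul (a (+) b) c = koszul a c * koszul b c.
Proof. by rewrite /koszul andb_addl signr_addb. Qed.

Lemma koszulDr a b c : koszul a (b (+) c) = koszul a b * koszul a c.
Proof. by rewrite /koszul andb_addr signr_addb. Qed.

Lemma koszul_sqr a b : koszul a b * koszul a b = 1.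
Proof. by rewrite /koszul -signr_addb addbb. Qed.
End Koszul.

Lemma sign_scale (K : pzRingType) (A : lalgType K) (d : nat) (u : A) :
  (-1) ^+ d * u = (-1) ^+ d *: u.
Proof. by rewrite -[in LHS]signr_odd mulr_sign -signr_odd scaler_sign. Qed.

(** A module generated by the vacuum under creation operators [mulv k], with
    annihilation operators [derv k]. The index k is odd when [par k] holds, and
    the relations carry the corresponding signs. Working over an abstract module
    keeps the arguments below independent of the encoding of the
    superpolynomials. *)
Record fock (K : fieldType) (N : nat) (par : 'I_N -> bool) (W : lmodType K) :=
Fock {
  mulv : 'I_N -> {linear W -> W};
  derv : 'I_N -> {linear W -> W};
  vac : W;
  mulvC : forall i k f,
    mulv i (mulv k f) = koszul K (par i) (par k) *: mulv k (mulv i f);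
  dervM : forall i k f, derv i (mulv k f) =
    (i == k)%:R *: f + koszul K (par i) (par k) *: mulv k (derv i f);
  derv_vac : forall i, derv i vac = 0;
  fock_ind : forall P : W -> Prop, P vac ->
    (forall c f g, P f -> P g -> P (c *: f + g)) ->
    (forall k f, P f -> P (mulv k f)) -> forall f, P f
}.

Section FockTheory.
Variables (K : fieldType) (N : nat) (par : 'I_N -> bool) (W : lmodType K).
Variable F : fock par W.
Implicit Types (f g : W) (i j k l : 'I_N) (X Y G H : 'M[K]_N) (a b : bool).
Notation x := (mulv F).
Notation d := (derv F).
Notation s := (koszul K).

Definition supported b X := forall i j, X i j != 0 -> par i (+) par j = b.

(** Column k of a matrix is the image of w_k in the defining representation, here
    as a multiplication operator. *)
Definition colv X k f : W := \sum_i X i k *: x i f.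
Definition glact X f : W := \sum_i \sum_j X i j *: x i (d j f).

Lemma sum_deltaZ (V : lmodType K) i (h : 'I_N -> V) :
  \sum_k (i == k)%:R *: h k = h i.
Proof.
rewrite (bigD1 i) //= eqxx scale1r big1 ?addr0 // => k /negPf ki.
by rewrite eq_sym ki scale0r.
Qed.

Lemma colv_is_linear X k : linear (colv X k).
Proof.
move=> c f g; rewrite /colv scaler_sumr -big_split; apply: eq_bigr => i _ /=.
by rewrite linearP scalerDr !scalerA mulrC.
Qed.
HB.instance Definition _ X k := GRing.isLinear.Build K W W _ (colv X k)
  (colv_is_linear X k).

Lemma colv1 k f : colv 1%:M k f = x k f.
Proof.
rewrite -(sum_deltaZ k (fun i => x i f)); apply: eq_bigr => i _.
by rewrite mxE eq_sym.
Qed.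

Lemma colvM X Y k f : colv (X *m Y) k f = \sum_j Y j k *: colv X j f.
Proof.
under [RHS]eq_bigr do rewrite scaler_sumr.
rewrite exchange_big; apply: eq_bigr => i _ /=; rewrite mxE scaler_suml.
by apply: eq_bigr => j _; rewrite scalerA mulrC.
Qed.

Lemma colvB X Y c k f :
  colv (X - c *: Y) k f = colv X k f - c *: colv Y k f.
Proof.
rewrite /colv scaler_sumr -sumrB; apply: eq_bigr => i _.
by rewrite !mxE scalerBl scalerA.
Qed.

Lemma glactE X f : glact X f = \sum_j colv X j (d j f).
Proof. by rewrite /glact exchange_big. Qed.

Lemma glact_is_linear X : linear (glact X).
Proof.
move=> c f g; rewrite !glactE scaler_sumr -big_split; apply: eq_bigr => j _ /=.
by rewrite !linearP.
Qed.
HB.instance Definition _ X := GRing.isLinear.Build K W W _ (glact X)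
  (glact_is_linear X).

Lemma glact_vac X : glact X (vac F) = 0.
Proof. by rewrite glactE big1 // => j _; rewrite derv_vac linear0. Qed.

(** The homogeneous elements of gl(m|n) act by superderivations, which reduces
    identities between their actions to the variables. *)
Lemma glactM a X k f : supported a X ->
  glact X (x k f) = colv X k f + s a (par k) *: x k (glact X f).
Proof.
move=> hX; have -> : colv X k f = \sum_j (k == j)%:R *: colv X j f.
  by rewrite sum_deltaZ.
rewrite !glactE raddf_sum scaler_sumr -big_split; apply: eq_bigr => j _ /=.
rewrite dervM linearP eq_sym; congr (_ + _).
rewrite linearZ /= /colv [X in _ = _ *: X]linear_sum !scaler_sumr.
apply: eq_bigr => i _ /=.
have [->|/hX <-] := eqVneq (X i j) 0; first by rewrite !scale0r !linear0.
rewrite [x k (_ *: _)]linearZ mulvC /= !scalerA koszulDl; congr (_ *: _) => /=.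
by rewrite mulrAC [s (par j) _ * s _ _]mulrC.
Qed.

Lemma supported_bracket a b X Y : supported a X -> supported b Y ->
  supported (a (+) b) (X *m Y - s a b *: (Y *m X)).
Proof.
move=> hX hY i j; apply: contraNeq => nab; rewrite !mxE.
have P c d A B : supported c A -> supported d B -> c (+) d = a (+) b ->
    \sum_k A i k * B k j = 0.
  move=> hA hB cd; apply: big1 => k _; apply/eqP; rewrite mulf_eq0.
  apply: contraNT nab; rewrite negb_or => /andP[/hA Aik /hB Bkj].
  by rewrite -cd -Aik -Bkj addbA -[(par i (+) _) (+) _]addbA addbb addbF.
by rewrite (P a b) // (P b a) 1?addbC // mulr0 subrr.
Qed.

(** Both sides are superderivations of parity a + b that kill the vacuum and
    agree on the variables; the cross terms of the double action on a product
    cancel in the supercommutator. *)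
Lemma glact_bracket a b X Y f : supported a X -> supported b Y ->
  glact (X *m Y - s a b *: (Y *m X)) f =
  glact X (glact Y f) - s a b *: glact Y (glact X f).
Proof.
move=> hX hY; have hZ := supported_bracket hX hY.
move: f; apply: (@fock_ind _ _ _ _ F) => [|c f g IHf IHg|k f IHf].
- by rewrite !(glact_vac, linear0) addr0.
- rewrite ![glact _ (_ + _)]linearP /= IHf IHg.
  move: (glact X _) (glact Y _) (glact X _) (glact Y _).
  by move=> u v w z; rewrite scalerBr scalerDr opprD addrACA !scalerA mulrC.
have XY c e A B : supported c A -> supported e B ->
    glact A (glact B (x k f)) = colv (A *m B) k f
      + (s c e * s c (par k)) *: colv B k (glact A f)
      + s e (par k) *: colv A k (glact B f)
      + (s e (par k) * s c (par k)) *: x k (glact A (glact B f)).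
  move=> hA hB; rewrite (glactM _ _ hB) linearD linearZ /= (glactM _ _ hA).
  rewrite scalerDr scalerA addrA; congr (_ + _ + _).
  rewrite colvM {1}/colv linear_sum {2}/colv scaler_sumr -big_split.
  apply: eq_bigr => j _ /=.
  rewrite [glact A (_ *: _)]linearZ /= (glactM _ _ hA) scalerDr.
  have [->|/hB <-] := eqVneq (B j k) 0; first by rewrite !(scale0r, scaler0).
  rewrite koszulDr -mulrA koszul_sqr mulr1.
  by rewrite !scalerA [_ * B _ _]mulrC.
rewrite (glactM _ _ hZ) colvB IHf (XY a b) // (XY b a) // koszulDl.
rewrite !scalerDr !scalerA !mulrA [s b a]koszulC koszul_sqr mul1r.
rewrite [x k (_ - _)]linearB [x k (_ *: _)]linearZ /= scalerBr scalerA.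
rewrite [s b (par k) * s a (par k)]mulrC.
rewrite [s a b * s a _ * s b _]mulrC [s a b * _]mulrC mulrA.
rewrite [s b (par k) * s a (par k)]mulrC.
set B1 := _ *: colv Y k (glact X f); set B2 := _ *: colv X k (glact Y f).
set B3 := _ *: colv (Y *m X) k f.
rewrite -(addrA _ B1 B2) -(addrA B3 B2 B1) (addrC B2).
rewrite [in RHS]opprD [RHS]addrACA opprD [_ + (B1 + B2) + (_ - _)]addrACA.
by rewrite subrr addr0.
Qed.

(** The algebra endomorphism sending w_k to sum_i G_ik w_i, characterised
    through left multiplication by the variables only. *)
Definition is_subst G (phi : W -> W) :=
  [/\ linear phi, phi (vac F) = vac F &
      forall k f, phi (x k f) = colv G k (phi f)].

Lemma is_subst_sum G phi (J : Type) (r : seq J) (P : pred J) (c : J -> K)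
    (h : J -> W) : is_subst G phi ->
  phi (\sum_(t <- r | P t) c t *: h t) = \sum_(t <- r | P t) c t *: phi (h t).
Proof.
case=> lin _ _; elim/big_rec2: _ => [|t u v _ <-].
  by have := lin (- 1) 0 0; rewrite scaleN1r addNr scaleN1r addNr.
exact: lin.
Qed.

Lemma is_substZ G phi c f : is_subst G phi -> phi (c *: f) = c *: phi f.
Proof.
move=> hphi; have := is_subst_sum [:: tt] predT (fun=> c) (fun=> f) hphi.
by rewrite !big_seq1.
Qed.

Lemma is_subst_colv G H phi k f : is_subst G phi ->
  phi (colv H k f) = colv (G *m H) k (phi f).
Proof.
move=> hphi; rewrite (is_subst_sum _ _ _ _ hphi) colvM.
by case: hphi => _ _ E; apply: eq_bigr => i _; rewrite E.
Qed.

Lemma is_subst_comp G H phi psi :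
  is_subst G phi -> is_subst H psi -> is_subst (G *m H) (phi \o psi).
Proof.
move=> hphi [lin v E]; split=> [c f g||k f] /=.
- by rewrite lin; case: hphi => ->.
- by rewrite v; case: hphi.
- by rewrite E (is_subst_colv _ _ _ hphi).
Qed.

Lemma is_subst_id : is_subst 1%:M id.
Proof. by split=> // k f; rewrite colv1. Qed.

Lemma is_subst_uniq G phi psi :
  is_subst G phi -> is_subst G psi -> phi =1 psi.
Proof.
move=> [lin v E] [lin' v' E']; apply: (@fock_ind _ _ _ _ F).
- by rewrite v v'.
- by move=> c f g IHf IHg; rewrite lin lin' IHf IHg.
- by move=> k f IHf; rewrite E E' IHf.
Qed.

Lemma supported_even G i j : supported false G -> G i j != 0 -> par i = par j.
Proof. by move=> hG /hG; case: (par i); case: (par j). Qed.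

(** The chain rule. Since G mixes only variables of equal parity, the signs
    produced by moving d_j past the image of w_k and by moving d_l past w_k
    agree. *)
Lemma derv_subst G phi j f : supported false G -> is_subst G phi ->
  d j (phi f) = \sum_l G j l *: phi (d l f).
Proof.
move=> hG hphi; have [lin v E] := hphi.
have phi0 : phi 0 = 0 by have := is_substZ 0 0 hphi; rewrite !scale0r.
move: f; apply: (@fock_ind _ _ _ _ F) => [|c f g IHf IHg|k f IHf].
- by rewrite v derv_vac big1 // => l _; rewrite derv_vac phi0 scaler0.
- rewrite lin linearP /= IHf IHg scaler_sumr -big_split; apply: eq_bigr => l _ /=.
  by rewrite linearP lin scalerDr !scalerA mulrC.
have -> : \sum_l G j l *: phi (d l (x k f)) =
    G j k *: phi f
    + \sum_l (G j l * s (par l) (par k)) *: colv G k (phi (d l f)).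
  rewrite -(sum_deltaZ k (fun l => G j l *: phi f)) -big_split.
  apply: eq_bigr => l _ /=; rewrite dervM lin (is_substZ _ _ hphi) E.
  by rewrite scalerDr !scalerA eq_sym [G _ _ * _]mulrC.
rewrite E /colv linear_sum /=.
under eq_bigr => i _ do
  rewrite linearZ /= dervM scalerDr scalerA [G _ _ * _]mulrC -scalerA.
rewrite big_split; congr (_ + _) => /=.
  exact: (sum_deltaZ j (fun i => G i k *: phi f)).
under eq_bigr => i _ do rewrite IHf [x i _]linear_sum !scaler_sumr.
under [RHS]eq_bigr => i _ do rewrite scaler_sumr.
rewrite [RHS]exchange_big /=; apply: eq_bigr => i _; apply: eq_bigr => l _.
rewrite [x i (_ *: _)]linearZ !scalerA.
have [->|/(supported_even hG) ->] := eqVneq (G j l) 0.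
  by rewrite !(mulr0, mul0r) !scale0r.
have [->|/(supported_even hG) ->] := eqVneq (G i k) 0.
  by rewrite !(mulr0, mul0r) !scale0r.
by rewrite mulrC mulrA mulrAC.
Qed.

(** G X H is the matrix of X in the new variables when H = G^-1: the G that the
    chain rule produces on the right cancels the factor H. *)
Lemma glact_conj G H X phi f : supported false G -> is_subst G phi ->
  H *m G = 1%:M -> glact (G *m X *m H) (phi f) = phi (glact X f).
Proof.
move=> hG hphi HG; have sumP := is_subst_sum _ _ _ _ hphi.
have -> : phi (glact X f) = \sum_l colv (G *m X) l (phi (d l f)).
  have -> : glact X f = \sum_l 1 *: colv X l (d l f).
    by rewrite glactE; under [RHS]eq_bigr do rewrite scale1r.
  rewrite sumP; apply: eq_bigr => l _.
  by rewrite scale1r (is_subst_colv _ _ _ hphi).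
rewrite glactE.
under eq_bigr => j _ do rewrite (derv_subst _ _ hG hphi) linear_sum /=.
rewrite exchange_big; apply: eq_bigr => l _ /=.
rewrite -{2}[G *m X]mulmx1 -HG mulmxA colvM.
by apply: eq_bigr => j _; rewrite linearZ.
Qed.

(** A family of symmetric forms, one for each total degree, that makes
    multiplication by w_k adjoint to d_k. *)
Variable B : nat -> W -> W -> K.
Hypothesis Blin : forall D f, linear_for *%R (B D f).
Hypothesis BC : forall D f g, B D f g = B D g f.
Hypothesis B0 : forall k f g, B 0 (x k f) g = 0.
Hypothesis Badj : forall D k f g, B D.+1 (x k f) g = B D f (d k g).

Lemma pairing0 D f : B D f 0 = 0.
Proof. by have := Blin D f (- 1) 0 0; rewrite scaleN1r addNr mulN1r addNr. Qed.

Lemma pairing_sum D f (c : 'I_N -> K) (h : 'I_N -> W) :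
  B D f (\sum_i c i *: h i) = \sum_i c i * B D f (h i).
Proof. by elim/big_rec2: _ => [|i u w _ <-]; rewrite ?pairing0 // Blin. Qed.

Lemma pairing_linl D c f f' g : B D (c *: f + f') g = c * B D f g + B D f' g.
Proof. by rewrite ![B D _ g]BC Blin. Qed.

Lemma pairing_vac G phi D g : is_subst G phi ->
  B D (vac F) (phi g) = B D (vac F) g.
Proof.
case=> lin v E.
have Z i h : B D (vac F) (x i h) = 0.
  by rewrite BC; case: D => [|D']; rewrite ?B0 // Badj derv_vac pairing0.
move: g; apply: (@fock_ind _ _ _ _ F) => [|c f g IHf IHg|k f IHf].
- by rewrite v.
- by rewrite lin !Blin IHf IHg.
- by rewrite E Z pairing_sum big1 // => i _; rewrite Z mulr0.
Qed.

(** Induction on f: moving w_k across the form turns it into d_k, to which the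
    chain rule applies. *)
Lemma pairing_subst G phi psi D f g : supported false G ->
  is_subst G phi -> is_subst G^T psi -> B D f (phi g) = B D (psi f) g.
Proof.
move=> hG hphi hpsi; have [_ v E] := hpsi; have [lin _ _] := hpsi.
move: f D g; apply: (@fock_ind _ _ _ _ F) => [D g|c f f' IHf IHf' D g|k f IHf D g].
- by rewrite v (pairing_vac _ _ hphi).
- by rewrite lin !pairing_linl IHf IHf'.
rewrite E /colv [RHS]BC pairing_sum; case: D => [|D].
  by rewrite B0 big1 // => i _; rewrite BC B0 mulr0.
rewrite Badj (derv_subst _ _ hG hphi) pairing_sum; apply: eq_bigr => i _.
by rewrite IHf mxE [in RHS]BC Badj.
Qed.
End FockTheory.

(** * Superpolynomials as a Fock module *)

Section Inversions.
Variable n : nat.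
Implicit Types (j k : 'I_n) (S T : {set 'I_n}).

Lemma inversions11 j k : inversions [set j] [set k] = (k < j)%N.
Proof. by rewrite /inversions !big_set1. Qed.

Lemma inversions1U j k S : k \notin S ->
  inversions [set j] (k |: S) = ((k < j) + inversions [set j] S)%N.
Proof.
move=> kS; rewrite (@inversionsUr _ _ [set k]) ?sub1set ?setU11 //.
by rewrite setU1K // inversions11.
Qed.

Lemma inversions1D j k S : k \in S ->
  inversions [set j] S = ((k < j) + inversions [set j] (S :\ k))%N.
Proof. by move=> kS; rewrite -[in LHS](setD1K kS) inversions1U ?setD11. Qed.

Lemma signr_ltC (A : pzRingType) j k : j != k ->
  (-1) ^+ (j < k)%N = - (-1) ^+ (k < j)%N :> A.
Proof.
rewrite -val_eqE neq_ltn => /orP[] jk; rewrite jk ltnNge ltnW //=.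
by rewrite opprK.
Qed.

End Inversions.

Section SuperWeyl.
Variables (K : fieldType) (m n : nat).
Notation SP := (superpoly K m n).
Implicit Types (f g : SP) (i k : 'I_(m + n)) (j l : 'I_n) (a b : 'I_m).

(** Left multiplication by x_a, by xi_j and by w_i, given coefficientwise so that
    the relations can be checked on coefficients without expanding the sum over
    subsets in the ring product. *)
Definition emul a f : SP := [ffun S : {set 'I_n} => 'X_a * f S].
Definition omul j f : SP :=
  [ffun S : {set 'I_n} => if j \in S
     then (-1) ^+ inversions [set j] (S :\ j) * f (S :\ j) else 0].
Definition smul i f : SP :=
  match split i with inl a => emul a f | inr j => omul j f end.

Lemma evarM a f : evar a * f = emul a f.
Proof.
apply/ffunP => S.
rewrite [LHS]ffunE (bigD1 set0) ?sub0set //= !ffunE eqxx setD0 inversions0l.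
rewrite mul1r.
by rewrite big1 ?addr0 // => T /andP[_ /negPf T0]; rewrite ffunE T0 mul0r mulr0.
Qed.

Lemma ovarM j f : ovar j * f = omul j f.
Proof.
apply/ffunP => S; rewrite [LHS]ffunE [RHS]ffunE; case: ifP => jS.
  rewrite (bigD1 [set j]) ?sub1set //= big1 ?addr0 => [|T /andP[_ /negPf Tj]].
    by rewrite ffunE eqxx mul1r.
  by rewrite ffunE Tj mul0r mulr0.
rewrite big1 // => T TS; rewrite ffunE; case: eqP => [TE|_]; last first.
  by rewrite mul0r mulr0.
by rewrite TE sub1set jS in TS.
Qed.

Lemma svarM i f : svar K i * f = smul i f.
Proof. by rewrite /svar /smul; case: (split i) => c; rewrite ?evarM ?ovarM. Qed.

Lemma emul_is_linear a : linear (emul a).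
Proof. by move=> c f g; apply/ffunP => S; rewrite !ffunE mulrDr -scalerAr. Qed.

Lemma omul_is_linear j : linear (omul j).
Proof.
move=> c f g; apply/ffunP => S; rewrite !ffunE.
by case: ifP => _; rewrite ?scaler0 ?addr0 // mulrDr -scalerAr.
Qed.

Lemma ederiv_is_linear a : linear (@ederiv K m n a).
Proof. by move=> c f g; apply/ffunP => S; rewrite !ffunE mderivD mderivZ. Qed.

Lemma oderiv_is_linear j : linear (@oderiv K m n j).
Proof.
move=> c f g; apply/ffunP => S; rewrite !ffunE.
by case: ifP => _; rewrite ?scaler0 ?addr0 // mulrDr -scalerAr.
Qed.

Lemma smul_is_linear i : linear (smul i).
Proof.
rewrite /smul; case: (split i) => c; first exact: emul_is_linear.
exact: omul_is_linear.
Qed.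
HB.instance Definition _ i := GRing.isLinear.Build K SP SP _ (smul i)
  (smul_is_linear i).

Lemma sderiv_is_linear i : linear (@sderiv K m n i).
Proof.
rewrite /sderiv; case: (split i) => c; first exact: ederiv_is_linear.
exact: oderiv_is_linear.
Qed.
HB.instance Definition _ i := GRing.isLinear.Build K SP SP _ (@sderiv K m n i)
  (sderiv_is_linear i).

Lemma idx_oddl a : idx_odd (lshift n a) = false.
Proof. by rewrite /idx_odd /= leqNgt ltn_ord. Qed.

Lemma idx_oddr j : idx_odd (rshift m j) = true.
Proof. by rewrite /idx_odd /= leq_addr. Qed.

Lemma svarl a : svar K (lshift n a) = evar a.
Proof. by rewrite /svar (unsplitK (inl a)). Qed.
Lemma svarr j : svar K (rshift m j) = ovar j.
Proof. by rewrite /svar (unsplitK (inr j)). Qed.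
Lemma smull a : smul (lshift n a) = emul a.
Proof. by rewrite /smul (unsplitK (inl a)). Qed.
Lemma smulr j : smul (rshift m j) = omul j.
Proof. by rewrite /smul (unsplitK (inr j)). Qed.
Lemma sderivl a : @sderiv K m n (lshift n a) = ederiv a.
Proof. by rewrite /sderiv (unsplitK (inl a)). Qed.
Lemma sderivr j : @sderiv K m n (rshift m j) = oderiv j.
Proof. by rewrite /sderiv (unsplitK (inr j)). Qed.

Lemma omulC j l f : omul j (omul l f) = - omul l (omul j f).
Proof.
apply/ffunP => S; rewrite !ffunE !in_setD1.
have [->|njl] := eqVneq j l; first by rewrite ?eqxx /= mulr0 if_same oppr0.
rewrite /=.
case: (boolP (j \in S)) => jS; case: (boolP (l \in S)) => lS;
  rewrite ?mulr0 ?oppr0 //.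
have lSj : l \in S :\ j by rewrite in_setD1 eq_sym njl.
have jSl : j \in S :\ l by rewrite in_setD1 njl.
have SE : S :\ j :\ l = S :\ l :\ j by rewrite !setDDl setUC.
rewrite (inversions1D _ lSj) (inversions1D _ jSl) SE !exprD (signr_ltC _ njl).
by rewrite !mulNr !mulrA opprK; congr (_ * _); rewrite mulrAC.
Qed.

Lemma oderivM j l f :
  oderiv j (omul l f) = (j == l)%:R *: f - omul l (oderiv j f).
Proof.
apply/ffunP => S; rewrite !ffunE in_setD1 in_setU1 [l == j]eq_sym.
have [<-|njl] := eqVneq j l.
  rewrite scale1r /=; case: (boolP (j \in S)) => jS.
    by rewrite setD1K // mulrA -expr2 sqrr_sign mul1r subrr.
  by rewrite setU1K // mulrA -expr2 sqrr_sign mul1r subr0.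
rewrite scale0r sub0r /=.
case: (boolP (j \in S)) => jS; case: (boolP (l \in S)) => lS;
  rewrite ?mulr0 ?oppr0 //.
have jSl : j \notin S :\ l by rewrite in_setD1 (negPf jS) andbF.
have SE : (j |: S) :\ l = j |: (S :\ l).
  by apply/setP => z; rewrite !inE; case: (z =P j) => // ->; rewrite njl.
rewrite SE inversions1U // (inversions1D _ lS) !exprD (signr_ltC _ njl).
by rewrite !(mulNr, mulrN) mulrACA [X in X * _]mulrA -expr2 sqrr_sign mul1r.
Qed.

Lemma emulC a b f : emul a (emul b f) = emul b (emul a f).
Proof. by apply/ffunP => S; rewrite !ffunE mulrCA. Qed.

Lemma emul_omul a j f : emul a (omul j f) = omul j (emul a f).
Proof.
by apply/ffunP => S; rewrite !ffunE; case: ifP; rewrite ?mulr0 // mulrCA.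
Qed.

Lemma ederivM a b f :
  ederiv a (emul b f) = (a == b)%:R *: f + emul b (ederiv a f).
Proof.
apply/ffunP => S; rewrite !ffunE mderivM mderivX mnm1E eq_sym.
have [<-|nab] := eqVneq a b; last by rewrite !scale0r mul0r.
have -> : (U_(a) - U_(a) = 0)%MM by apply/mnmP => c; rewrite mnmBE subnn mnm0E.
by rewrite !scale1r mpolyX0 mul1r.
Qed.

Lemma ederiv_omul a j f : ederiv a (omul j f) = omul j (ederiv a f).
Proof.
apply/ffunP => S; rewrite !ffunE; case: ifP => _; last exact: mderiv0.
by rewrite !sign_scale mderivZ.
Qed.

Lemma oderiv_emul j a f : oderiv j (emul a f) = emul a (oderiv j f).
Proof.
by apply/ffunP => S; rewrite !ffunE; case: ifP; rewrite ?mulr0 // mulrCA.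
Qed.

Lemma smulC i k f :
  smul i (smul k f) = koszul K (idx_odd i) (idx_odd k) *: smul k (smul i f).
Proof.
case: (split_ordP i) => a ->; case: (split_ordP k) => b ->;
  rewrite !(idx_oddl, idx_oddr, smull, smulr).
- by rewrite scale1r emulC.
- by rewrite scale1r emul_omul.
- by rewrite scale1r emul_omul.
- by rewrite scaleN1r omulC.
Qed.

Lemma sderivM i k f : sderiv i (smul k f) = (i == k)%:R *: f
  + koszul K (idx_odd i) (idx_odd k) *: smul k (sderiv i f).
Proof.
case: (split_ordP i) => a ->; case: (split_ordP k) => b ->;
  rewrite !(idx_oddl, idx_oddr, smull, smulr, sderivl, sderivr).
- by rewrite scale1r ederivM eq_lshift.
- by rewrite scale1r ederiv_omul eq_lrshift scale0r add0r.
- by rewrite scale1r oderiv_emul eq_rlshift scale0r add0r.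
- by rewrite scaleN1r oderivM eq_rshift.
Qed.

Lemma ext1E (S : {set 'I_n}) : (1 : SP) S = (S == set0)%:R.
Proof. by rewrite ffunE. Qed.

Lemma sderiv1 i : sderiv i (1 : SP) = 0.
Proof.
case: (split_ordP i) => a ->; rewrite ?sderivl ?sderivr; apply/ffunP => S;
  rewrite !ffunE.
  by case: eqP => _; rewrite ?mderiv0 // -[1]/(1%:MP) mderivC.
case: ifP => // _; rewrite (_ : (a |: S == set0) = false) ?mulr0 //.
by apply/negP => /eqP/setP/(_ a); rewrite in_set0 setU11.
Qed.

End SuperWeyl.

(** A relation preserved by multiplying both sides by corresponding generators
    relates corresponding ordered products; it is stated for a relation so as
    to serve both for induction on monomials and for computing the image of a
    product under a map that is only known to commute with multiplication by
    generators. *)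
Lemma prod_rel (A : nzRingType) (Q : A -> A -> Prop) (N : nat)
    (w w' : 'I_N -> A) (e : 'I_N -> nat) :
  (forall k f g, Q f g -> Q (w k * f) (w' k * g)) ->
  forall f g, Q f g ->
    Q (\prod_(k < N) w k ^+ e k * f) (\prod_(k < N) w' k ^+ e k * g).
Proof.
move=> Qw; elim/big_rec2: _ => [|k u v _ IH] f g Qfg; first by rewrite !mul1r.
rewrite -!mulrA; elim: (e k) => [|d IHd]; first by rewrite !mul1r; apply: IH.
by rewrite !exprS -!mulrA; apply: Qw.
Qed.

Lemma smonom_rel (A : nzRingType) (Q : A -> A -> Prop) (m n D : nat)
    (X X' : 'I_m -> A) (Y Y' : 'I_n -> A) (t : sidx m n D) :
  (forall k f g, Q f g -> Q (X k * f) (X' k * g)) ->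
  (forall k f g, Q f g -> Q (Y k * f) (Y' k * g)) -> Q 1 1 ->
  Q (smonom X Y t) (smonom X' Y' t).
Proof.
move=> QX QY Q1; apply: prod_rel => //.
by rewrite -[X in Q X _]mulr1 -[X in Q _ X]mulr1; apply: prod_rel.
Qed.

Lemma eq_smonom (A : nzRingType) (m n D : nat) (X X' : 'I_m -> A)
    (Y Y' : 'I_n -> A) (t : sidx m n D) :
  X =1 X' -> Y =1 Y' -> smonom X Y t = smonom X' Y' t.
Proof.
by move=> XX' YY'; apply: (@smonom_rel A eq) => // k f g ->; rewrite (XX', YY').
Qed.

(** Moving e_j to its place in the ordered product crosses the e_k with k in T
    and k < j, each crossing changing the sign. *)
Lemma anti_insert (A : nzRingType) (n : nat) (e : 'I_n -> A) :
  (forall i j, e i * e j = - (e j * e i)) -> (forall i, e i * e i = 0) ->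
  forall j (T : {set 'I_n}), e j * \prod_k e k ^+ (k \in T) =
    if j \in T then 0
    else (-1) ^+ inversions [set j] T * \prod_k e k ^+ (k \in j |: T).
Proof.
move=> eC e2 j T.
have eX i (b : bool) : e j * e i ^+ b = (-1) ^+ b * (e i ^+ b * e j).
  by case: b; rewrite ?expr1 ?expr0 ?mulr1 ?mul1r // mulN1r eC.
pose P (r : seq 'I_n) (U : {set 'I_n}) := \prod_(k <- r) e k ^+ (k \in U).
have PE (U : {set 'I_n}) : \prod_k e k ^+ (k \in U) = P (enum 'I_n) U.
  by rewrite /P -[RHS]big_filter filter_predT -[LHS]big_filter enumT filter_predT.
have je : j \in enum 'I_n by rewrite mem_enum.
rewrite !PE; case: ifP => jT.
  elim: (enum 'I_n) je => // i r IHr; rewrite inE /P big_cons.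
  have [<- _|nji /= /IHr E] := eqVneq j i.
    by rewrite jT expr1 mulrA e2 mul0r.
  by rewrite mulrA eX -!mulrA E !mulr0.
have -> : inversions [set j] T = (\sum_(k <- enum 'I_n) ((k \in T) && (k < j)))%N.
  rewrite /inversions big_set1 big_enum big_mkcond /=; apply: eq_bigr => k _.
  by case: (k \in T).
have : sorted (fun i k : 'I_n => (i < k)%N) (enum 'I_n).
  by rewrite -(@sorted_map _ _ val ltn) val_enum_ord iota_ltn_sorted.
elim: (enum 'I_n) je => // i r IHr; rewrite inE /P !big_cons /=.
rewrite path_sortedE; last by move=> x y z; apply: ltn_trans.
have [<- _ /andP[/allP jr _]|nji /= jr /andP[/allP/(_ _ jr) ij sr]] := eqVneq j i.
  have -> : (\sum_(k <- r) ((k \in T) && (k < j)))%N = 0%N.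
    rewrite big_seq big1 // => k /jr jk.
    by rewrite [(k < j)%N]ltnNge ltnW // andbF.
  rewrite jT setU11 expr0 !mul1r expr1; congr (_ * _).
  rewrite big_seq [RHS]big_seq; apply: eq_bigr => k /jr jk.
  by rewrite in_setU1 -val_eqE gtn_eqF.
rewrite in_setU1 eq_sym (negPf nji) mulrA eX -!mulrA (IHr jr sr) ij andbT.
rewrite exprD.
rewrite -!mulrA; congr (_ * _); rewrite !mulrA; congr (_ * _).
by rewrite -signr_odd; case: odd; rewrite ?(mulrN1, mulN1r) // mulr1 mul1r.
Qed.

Section Fock.
Variables (K : numFieldType) (m n : nat).
Notation SP := (superpoly K m n).
Implicit Types (f g : SP) (i k : 'I_(m + n)).

Definition mono (b : 'X_{1..m}) (S : {set 'I_n}) : SP := ext_mon 'X_[b] S.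

Lemma mono_prod b S : mono b S =
  \prod_i evar i ^+ b i * \prod_j ovar j ^+ (j \in S).
Proof.
rewrite prod_evar prod_ovar; apply/ffunP => T.
by rewrite ext_monMl !ffunE; case: eqP; rewrite ?mulr1 ?mulr0.
Qed.

Lemma superpolyE f :
  f = \sum_(S : {set 'I_n}) \sum_(b <- msupp (f S)) (f S)@_b *: mono b S.
Proof.
apply/ffunP => T; rewrite sum_ffunE (bigD1 T) //= [X in _ + X]big1 => [|S /negPf ST].
  rewrite addr0 sum_ffunE {1}[f T]mpolyE; apply: eq_bigr => b _.
  by rewrite !ffunE eqxx.
rewrite sum_ffunE big1 // => b _.
by rewrite !ffunE eq_sym ST scaler0.
Qed.

Lemma mono_span (P : SP -> Prop) :
  (forall c f g, P f -> P g -> P (c *: f + g)) ->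
  (forall b S, P (mono b S)) -> forall f, P f.
Proof.
move=> Plin Pm f.
have P0 : P 0.
  by rewrite -(addNr (mono 0 set0)) -scaleN1r; apply: Plin.
rewrite [f]superpolyE; elim/big_rec: _ => [|S g _ Pg] //.
elim/big_rec: _ => [|b h _ Ph]; rewrite ?add0r // -addrA; exact: Plin.
Qed.

Lemma superpoly_ind (P : SP -> Prop) : P 1 ->
  (forall c f g, P f -> P g -> P (c *: f + g)) ->
  (forall k f, P f -> P (smul k f)) -> forall f, P f.
Proof.
move=> P1 Plin Pmul; apply: mono_span => // b S; rewrite mono_prod.
apply: (@prod_rel SP (fun f _ => P f) m evar evar b _ _ 1) => [i f _ Pf|].
  by rewrite -(svarl K n) svarM; apply: Pmul.
rewrite -[X in P X]mulr1.
apply: (@prod_rel SP (fun f _ => P f) n ovar ovar _ _ _ 1) => // j f _ Pf.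
by rewrite -(svarr K m) svarM; apply: Pmul.
Qed.

Definition superpoly_fock : fock (@idx_odd m n) (superpoly K m n) :=
  @Fock K (m + n) (@idx_odd m n) (superpoly K m n) (fun i => smul i)
    (fun i => @sderiv K m n i) 1 (@smulC K m n) (@sderivM K m n)
    (@sderiv1 K m n) superpoly_ind.
End Fock.

(** * Linear substitutions *)

Section Substitution.
Variables (K : numFieldType) (m n : nat).
Notation SP := (superpoly K m n).
Implicit Types (f g : SP) (i k : 'I_(m + n)) (R : 'M[K]_m) (S : 'M[K]_n).
Let F := superpoly_fock K m n.

Definition pmul (p : {mpoly K[m]}) f : SP := [ffun T : {set 'I_n} => p * f T].

Lemma pmulD p q f : pmul (p + q) f = pmul p f + pmul q f.
Proof. by apply/ffunP => T; rewrite !ffunE mulrDl. Qed.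

Lemma pmulZ c p f : pmul (c *: p) f = c *: pmul p f.
Proof. by apply/ffunP => T; rewrite !ffunE scalerAl. Qed.

Lemma pmulM p q f : pmul (p * q) f = pmul p (pmul q f).
Proof. by apply/ffunP => T; rewrite !ffunE mulrA. Qed.

Lemma pmul0 f : pmul 0 f = 0.
Proof. by apply/ffunP => T; rewrite !ffunE mul0r. Qed.

Lemma pmul1 f : pmul 1 f = f.
Proof. by apply/ffunP => T; rewrite !ffunE mul1r. Qed.

Lemma pmul_is_linear p : linear (pmul p).
Proof. by move=> c f g; apply/ffunP => T; rewrite !ffunE mulrDr -scalerAr. Qed.
HB.instance Definition _ p := GRing.isLinear.Build K SP SP _ (pmul p)
  (pmul_is_linear p).

Lemma pmul_omul p j f : pmul p (omul j f) = omul j (pmul p f).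
Proof.
by apply/ffunP => T; rewrite !ffunE; case: ifP; rewrite ?mulr0 // mulrCA.
Qed.

(** The images of the even variables, as polynomials, and of the odd ones. *)
Definition evars R : m.-tuple {mpoly K[m]} :=
  [tuple \sum_i R i k *: 'X_i | k < m].
Definition ocol S j : SP := \sum_i S i j *: ovar i.

Lemma ocolM S j f : ocol S j * f = \sum_i S i j *: omul i f.
Proof. by rewrite mulr_suml; apply: eq_bigr => i _; rewrite -scalerAl ovarM. Qed.

Lemma ovarC (k l : 'I_n) : (ovar k : SP) * ovar l = - (ovar l * ovar k).
Proof.
have E (i j : 'I_n) : (ovar i : SP) * ovar j = omul i (omul j 1).
  by rewrite -!ovarM mulr1.
by rewrite !E omulC.
Qed.

Lemma ocolC S (i j : 'I_n) : ocol S i * ocol S j = - (ocol S j * ocol S i).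
Proof.
have E (a b : 'I_n) : ocol S a * ocol S b =
    \sum_k \sum_l (S k a * S l b) *: (ovar k * ovar l : SP).
  rewrite /ocol mulr_suml; apply: eq_bigr => k _; rewrite mulr_sumr.
  by apply: eq_bigr => l _; rewrite -scalerAl -scalerAr scalerA.
rewrite !E exchange_big -sumrN; apply: eq_bigr => l _ /=.
by rewrite -sumrN; apply: eq_bigr => k _; rewrite ovarC scalerN mulrC.
Qed.

Lemma ocol_sqr S (j : 'I_n) : ocol S j * ocol S j = 0.
Proof.
have /eqP := ocolC S j j; rewrite -addr_eq0 -mulr2n -scaler_nat scaler_eq0.
by rewrite Num.Theory.pnatr_eq0 => /eqP.
Qed.

Definition osubst S (T : {set 'I_n}) : SP := \prod_j ocol S j ^+ (j \in T).

Lemma ocol_osubst S j T : ocol S j * osubst S T =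
  if j \in T then 0 else (-1) ^+ inversions [set j] T *: osubst S (j |: T).
Proof.
rewrite (anti_insert (ocolC S) (ocol_sqr S)); case: ifP => _; first by [].
by rewrite sign_scale.
Qed.

(** A substitution is determined by its linearity and its effect on left
    multiples of the variables, so it is defined on the basis: substitute in the
    polynomial coefficients and replace each xi_T by the ordered product of the
    images. *)
Definition lsubst R S f : SP := \sum_(T : {set 'I_n})
  pmul (f T \mPo evars R) (osubst S T).

Definition subst_mx R S : 'M[K]_(m + n) := block_mx R 0 0 S.

Lemma supported_subst_mx R S : supported (@idx_odd m n) false (subst_mx R S).
Proof.
move=> i k; rewrite /subst_mx.
case: (split_ordP i) => a ->; case: (split_ordP k) => b ->;
  by rewrite ?(block_mxEul, block_mxEur, block_mxEdl, block_mxEdr)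
    !(idx_oddl, idx_oddr) // mxE eqxx.
Qed.

Lemma pmul_sum R a f :
  pmul (\sum_i R i a *: 'X_i) f = \sum_i R i a *: emul i f.
Proof.
apply/ffunP => T; rewrite sum_ffunE ffunE mulr_suml.
by apply: eq_bigr => i _; rewrite !ffunE scalerAl.
Qed.

Lemma colv_substl R S a f :
  colv F (subst_mx R S) (lshift n a) f = pmul (\sum_i R i a *: 'X_i) f.
Proof.
rewrite /colv big_split_ord /= [X in _ + X]big1 ?addr0 => [|i _]; last first.
  by rewrite block_mxEdl mxE scale0r.
by rewrite pmul_sum; apply: eq_bigr => i _; rewrite block_mxEul smull.
Qed.

Lemma colv_substr R S j f :
  colv F (subst_mx R S) (rshift m j) f = ocol S j * f.
Proof.
rewrite /colv big_split_ord /= big1 ?add0r => [|i _]; last first.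
  by rewrite block_mxEur mxE scale0r.
by rewrite ocolM; apply: eq_bigr => i _; rewrite block_mxEdr smulr.
Qed.

(** The odd case is where signs matter: both sides are sums over the sets T not
    containing the index a, and the sign of inserting a into T is the same for
    xi_T ([omul]) and for the product of the images ([ocol_osubst]). *)
Lemma is_subst_lsubst R S : is_subst F (subst_mx R S) (lsubst R S).
Proof.
split=> [c f g||k f].
- rewrite /lsubst scaler_sumr -big_split; apply: eq_bigr => T _ /=.
  by rewrite !ffunE comp_mpolyD comp_mpolyZ pmulD pmulZ.
- rewrite /lsubst (bigD1 set0) //= big1 ?addr0 => [|T /negPf T0]; last first.
    by rewrite ext1E T0 comp_mpoly0 pmul0.
  rewrite ext1E eqxx comp_mpoly1 pmul1 /osubst big1 // => j _.
  by rewrite in_set0 expr0.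
case: (split_ordP k) => a -> /=.
  rewrite colv_substl /lsubst linear_sum; apply: eq_bigr => T _ /=.
  rewrite smull !ffunE rmorphM /= pmulM; congr (pmul _ _).
  rewrite comp_mpolyXU (nth_map (Ordinal (ltn_ord a))) ?size_enum_ord //.
  by rewrite nth_ord_enum.
rewrite colv_substr /lsubst smulr mulr_sumr.
have pM p g : ocol S a * pmul p g = pmul p (ocol S a * g).
  rewrite !ocolM linear_sum; apply: eq_bigr => i _ /=.
  by rewrite -pmul_omul linearZ.
under [RHS]eq_bigr => T _ do rewrite pM ocol_osubst.
rewrite (bigID (fun T : {set 'I_n} => a \in T)) /=.
rewrite [X in _ + X]big1 ?addr0; last first.
  by move=> T /negPf aT; rewrite ffunE aT comp_mpoly0 pmul0.
rewrite [RHS](bigID (fun T : {set 'I_n} => a \in T)) /=.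
rewrite [X in _ = X + _]big1 ?add0r; last first.
  by move=> T ->; rewrite linear0.
rewrite (reindex_onto (fun T => a |: T) (fun T => T :\ a)) /=; last first.
  by move=> T aT; rewrite setD1K.
apply: eq_big => [T|T /andP[_ /eqP Ta]].
  rewrite setU11 /=; apply/eqP/idP => [<-|aT]; first by rewrite setD11.
  by rewrite setU1K.
have aT : a \notin T by rewrite -Ta setD11.
rewrite (negPf aT) ffunE setU11 Ta linearZ /= -pmulZ; congr (pmul _ _).
by rewrite sign_scale comp_mpolyZ.
Qed.

End Substitution.

(** * The pairing *)

Section Pairing.
Variables (K : numFieldType) (m n : nat).
Notation SP := (superpoly K m n).
Implicit Types (f g : SP) (i k : 'I_(m + n)) (R : 'M[K]_m) (S : 'M[K]_n).
Implicit Types (b : 'X_{1..m}) (T : {set 'I_n}).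

Lemma mcoeff_mono b T c (Z : {set 'I_n}) :
  (mono K b T Z)@_c = ((Z == T) && (b == c))%:R.
Proof. by rewrite ffunE; case: (Z == T); rewrite /= ?mcoeffX ?mcoeff0. Qed.

(** Cutting the form by the exact degree keeps the sum finite, and lets the
    adjunction [pairing_adj] relate two consecutive degrees for all f and g. *)
Definition pairing D f g : K := \sum_(t in AD m n D)
  (mfact t.1)%:R * (f t.2)@_(t.1) * (g t.2)@_(t.1).

Lemma pairingC D f g : pairing D f g = pairing D g f.
Proof. by apply: eq_bigr => t _; rewrite mulrAC. Qed.

Lemma pairing_linr D f : linear_for *%R (pairing D f).
Proof.
move=> c g h; rewrite /pairing mulr_sumr -big_split; apply: eq_bigr => t _ /=.
by rewrite !ffunE mcoeffD mcoeffZ mulrDr mulrCA.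
Qed.

Definition bidx D b T (bD : (mdeg b + #|T| == D)%N) : sidx m n D :=
  (BMultinom (leq_trans (leq_addr #|T| (mdeg b)) (eq_leq (eqP bD))
              : mdeg b < D.+1)%N, T).

Lemma bidx_eq D b T (bD : (mdeg b + #|T| == D)%N)
    (t : sidx m n D) :
  b = t.1 -> T = t.2 -> t = bidx bD.
Proof.
by move=> bt Tt; rewrite [t]surjective_pairing -Tt; congr (_, _); apply: val_inj.
Qed.

Lemma pairing_mono D b T g : pairing D (mono K b T) g =
  if (mdeg b + #|T| == D)%N then (mfact b)%:R * (g T)@_b else 0.
Proof.
rewrite /pairing; case: ifP => [bD|nbD]; last first.
  rewrite big1 // => t; rewrite inE mcoeff_mono => tD.
  case: eqP => [tT|_]; last by rewrite mulr0 mul0r.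
  case: eqP => [bt|_]; last by rewrite mulr0 mul0r.
  by rewrite -tT bt tD in nbD.
rewrite (bigD1 (bidx bD)) ?inE //= mcoeff_mono !eqxx mulr1.
rewrite big1 ?addr0 // => t /andP[_ nt]; rewrite mcoeff_mono.
case: eqP => [tT|_]; last by rewrite mulr0 mul0r.
case: eqP => [bt|_]; last by rewrite mulr0 mul0r.
by case/eqP: nt; apply: bidx_eq.
Qed.

Lemma emul_mono (a : 'I_m) b T : emul a (mono K b T) = mono K (b + U_(a))%MM T.
Proof.
apply/ffunP => Z; rewrite !ffunE; case: eqP; rewrite ?mulr0 // => _.
by rewrite mpolyXD mulrC.
Qed.

Lemma omul_mono (j : 'I_n) b T : omul j (mono K b T) =
  if j \in T then 0 else (-1) ^+ inversions [set j] T *: mono K b (j |: T).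
Proof.
apply/ffunP => Z; rewrite ffunE.
case: ifP => jZ; case: ifP => jT.
- rewrite !ffunE; case: eqP => [ZT|]; rewrite ?mulr0 //.
  by rewrite -ZT setD11 in jT.
- rewrite !ffunE; case: eqP => [ZT|ZT].
    rewrite -ZT setD1K // eqxx.
    exact: sign_scale.
  rewrite (_ : (Z == j |: T) = false) ?mulr0 ?scaler0 //.
  by apply/eqP => ZE; case: ZT; rewrite ZE setU1K ?jT.
- by rewrite ffunE.
- rewrite !ffunE (_ : (Z == j |: T) = false) ?scaler0 //.
  by apply/eqP => ZE; rewrite ZE setU11 in jZ.
Qed.

Lemma mfactU b (a : 'I_m) : mfact (b + U_(a)) = (mfact b * (b a).+1)%N.
Proof.
rewrite /mfact (bigD1 a) //= [in RHS](bigD1 a) //= mnmDE mnm1E eqxx addn1 factS.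
rewrite -mulnA [LHS]mulnC; congr (_ * _ * _)%N.
by apply: eq_bigr => c ca; rewrite mnmDE mnm1E eq_sym (negPf ca) addn0.
Qed.

(** For x_a the factor b_a + 1 of the derivative is (b + e_a)! / b!; for xi_j the
    signs of [omul] and of [oderiv] are both given by the place of j. *)
Lemma pairing_adj D k f g : pairing D.+1 (smul k f) g = pairing D f (sderiv k g).
Proof.
have lin D' (h : SP) c f1 f2 : pairing D' (c *: f1 + f2) h
    = c * pairing D' f1 h + pairing D' f2 h.
  by rewrite ![pairing _ _ h]pairingC pairing_linr.
move: f; apply: mono_span => [c f1 f2 IH1 IH2|b T].
  by rewrite linearP !lin IH1 IH2.
case: (split_ordP k) => a ->; rewrite ?(smull, smulr) ?(sderivl, sderivr).
  rewrite emul_mono !pairing_mono mdegD mdeg1 addn1 addSn eqSS; case: ifP => // _.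
  rewrite ffunE mcoeff_deriv mfactU natrM -mulrA; congr (_ * _).
  exact: mulr_natl.
rewrite omul_mono pairing_mono ffunE; case: ifP => aT.
  rewrite mcoeff0 mulr0 if_same pairingC /pairing big1 // => t _.
  by rewrite ffunE mcoeff0 mulr0.
rewrite -[_ *: _]addr0 lin [X in _ + X](_ : _ = 0) ?addr0; last first.
  by rewrite /pairing big1 // => t _; rewrite ffunE mcoeff0 mulr0 mul0r.
rewrite pairing_mono cardsU1 aT /= add1n addnS eqSS; case: ifP => _; last first.
  by rewrite mulr0.
by rewrite mulrCA sign_scale mcoeffZ.
Qed.

Lemma pairing_degree0 k f g : pairing 0 (smul k f) g = 0.
Proof.
rewrite /pairing big1 // => t; rewrite inE addn_eq0 => /andP[/eqP tm /eqP tn].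
have t2 : t.2 = set0 by apply/eqP; rewrite -cards_eq0 tn.
have t1 : (t.1 : 'X_{1..m}) = 0%MM by apply/eqP; rewrite -mdeg_eq0 tm.
rewrite t2 t1; case: (split_ordP k) => a ->; rewrite ?(smull, smulr) ffunE.
  by rewrite rmorphM /= mcoeffX mnm1_eq0 mul0r mulr0 mul0r.
by rewrite in_set0 mcoeff0 mulr0 mul0r.
Qed.

End Pairing.

(** * Krawtchouk polynomials as matrix entries of substitutions *)

Section Krawtchouk.
Variables (K : numFieldType) (m n D : nat).
Notation SP := (superpoly K m n).
Implicit Types (f g : SP) (R U : 'M[K]_m) (S V : 'M[K]_n) (t : sidx m n D).
Let F := superpoly_fock K m n.

Lemma subst_mxM R S R' S' :
  subst_mx R S *m subst_mx R' S' = subst_mx (R *m R') (S *m S').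
Proof.
by rewrite /subst_mx mulmx_block !mulmx0 !mul0mx !addr0 add0r.
Qed.

Lemma subst_mx1 : subst_mx (1%:M : 'M[K]_m) (1%:M : 'M[K]_n) = 1%:M.
Proof. by rewrite /subst_mx -scalar_mx_block. Qed.

Lemma lsubst_comp R S R' S' f :
  lsubst R S (lsubst R' S' f) = lsubst (R *m R') (S *m S') f.
Proof.
have h := is_subst_comp (is_subst_lsubst R S) (is_subst_lsubst R' S').
by rewrite subst_mxM in h; apply: (is_subst_uniq h (is_subst_lsubst _ _)).
Qed.

Lemma lsubst1 f : lsubst 1%:M 1%:M f = f.
Proof.
have h := is_subst_lsubst (1%:M : 'M[K]_m) (1%:M : 'M[K]_n).
by rewrite subst_mx1 in h; apply: (is_subst_uniq h (is_subst_id _)).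
Qed.

Lemma lsubst_sum R S (J : Type) (r : seq J) (P : pred J) c (h : J -> SP) :
  lsubst R S (\sum_(t <- r | P t) c t *: h t)
  = \sum_(t <- r | P t) c t *: lsubst R S (h t).
Proof. exact: is_subst_sum (is_subst_lsubst R S). Qed.

Lemma lsubstZ R S c f : lsubst R S (c *: f) = c *: lsubst R S f.
Proof. exact: is_substZ (is_subst_lsubst R S). Qed.

Lemma lsubst_xmonom R S t : lsubst R S (xmonom K t) =
  smonom (fun k => \sum_i R i k *: evar i) (fun k => \sum_i S i k *: ovar i) t.
Proof.
have [_ v E] := is_subst_lsubst R S.
apply: (@smonom_rel SP (fun f g => lsubst R S f = g)) => // k f _ <-.
  rewrite -(svarl K n) svarM [LHS]E colv_substl pmul_sum mulr_suml.
  by apply: eq_bigr => i _; rewrite -scalerAl evarM.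
by rewrite -(svarr K m) svarM [LHS]E colv_substr.
Qed.

Lemma krawtchouk_genE_subst U V t :
  krawtchouk_gen U V t = lsubst U^T V^T (xmonom K t).
Proof.
rewrite lsubst_xmonom /krawtchouk_gen; apply: eq_smonom => k.
  by apply: eq_bigr => i _; rewrite mxE.
by apply: eq_bigr => i _; rewrite mxE.
Qed.

Lemma pairing_xmonom t f : t \in AD m n D ->
  pairing D (xmonom K t) f = (mfact t.1)%:R * (f t.2)@_(t.1).
Proof. by rewrite inE xmonomE => tD; rewrite [LHS]pairing_mono tD. Qed.

Lemma pairing_lsubst R S f g :
  pairing D f (lsubst R S g) = pairing D (lsubst R^T S^T f) g.
Proof.
apply: (pairing_subst (F := F)).
- exact: pairing_linr.
- exact: pairingC.
- exact: pairing_degree0.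
- exact: pairing_adj.
- exact: supported_subst_mx.
- exact: is_subst_lsubst.
- rewrite /subst_mx tr_block_mx !trmx0; exact: is_subst_lsubst.
Qed.

Lemma super_krawtchoukE U V t t' : t \in AD m n D ->
  super_krawtchouk U V t t' =
  pairing D (xmonom K t) (lsubst U^T V^T (xmonom K t')) / (D`!)%:R.
Proof.
by move=> tD; rewrite pairing_xmonom // -krawtchouk_genE_subst mulrAC.
Qed.

Lemma super_krawtchouk_tr U V t t' : t \in AD m n D -> t' \in AD m n D ->
  super_krawtchouk U V t t' = super_krawtchouk U^T V^T t' t.
Proof.
move=> tD t'D; rewrite [LHS](super_krawtchoukE _ _ _ tD).
rewrite [RHS](super_krawtchoukE _ _ _ t'D).
apply: (congr1 (fun z => z / (D`!)%:R)).
by rewrite [LHS]pairing_lsubst [RHS]pairingC !trmxK.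
Qed.

Lemma smonomZ (c : 'I_m -> K) (e : 'I_n -> K) (X : 'I_m -> SP) (Y : 'I_n -> SP) t :
  smonom (fun k => c k *: X k) (fun k => e k *: Y k) t =
  smonom c e t *: smonom X Y t.
Proof.
rewrite /smonom -scalerA scalerAr scalerAl -!scaler_prod.
by congr (_ * _); apply: eq_bigr => k _; rewrite exprZn.
Qed.

Lemma card_sum_in (T : {set 'I_n}) : (\sum_(k < n) (k \in T))%N = #|T|.
Proof.
by rewrite -sum1_card [RHS]big_mkcond; apply: eq_bigr => k _; case: (k \in T).
Qed.

Lemma smonomM (a b : K) (c : 'I_m -> K) (e : 'I_n -> K) t :
  smonom (fun k => a * c k) (fun k => b * e k) t =
  a ^+ mdeg t.1 * b ^+ #|t.2| * smonom c e t.
Proof.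
have bT : b ^+ #|t.2| = \prod_(k < n) b ^+ (k \in t.2).
  by rewrite -expr_sum card_sum_in.
rewrite /smonom bT mdegE expr_sum mulrACA -!big_split /=.
by congr (_ * _); apply: eq_bigr => k _; rewrite exprMn.
Qed.

Lemma lsubst_diag (r : 'rV[K]_m) (s : 'rV[K]_n) t :
  lsubst (diag_mx r) (diag_mx s) (xmonom K t) = smonom (r 0) (s 0) t *: xmonom K t.
Proof.
rewrite lsubst_xmonom -smonomZ; apply: eq_smonom => k.
  rewrite (bigD1 k) //= big1 ?addr0 => [|i /negPf ik]; first by rewrite mxE eqxx.
  by rewrite mxE ik scale0r.
rewrite (bigD1 k) //= big1 ?addr0 => [|i /negPf ik]; first by rewrite mxE eqxx.
by rewrite mxE ik scale0r.
Qed.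

(** Multiplying all the xi_j by 2 commutes with every substitution and multiplies
    a monomial of odd degree d by 2^d, so substitutions preserve the odd
    degree. *)
Lemma super_krawtchouk_parity U V t t' : t \in AD m n D ->
  #|t.2| != #|t'.2| -> super_krawtchouk U V t t' = 0.
Proof.
move=> tD ntt'; rewrite super_krawtchoukE //.
have E (t0 : sidx m n D) :
    lsubst 1%:M 2%:M (xmonom K t0) = 2 ^+ #|t0.2| *: xmonom K t0.
  rewrite -!diag_const_mx lsubst_diag.
  have -> : smonom ((const_mx 1 : 'rV[K]_m) 0) ((const_mx 2 : 'rV[K]_n) 0) t0 =
      smonom (fun=> 1 * 1) (fun=> 2 * 1) t0.
    by apply: eq_smonom => k; rewrite mxE mulr1.
  rewrite smonomM /smonom expr1n mul1r !big1 ?mulr1 // => k _; exact: expr1n.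
set x := pairing _ _ _; suff -> : x = 0 by rewrite mul0r.
have : 2 ^+ #|t.2| * x = 2 ^+ #|t'.2| * x.
  have ZE c f g : pairing D f (c *: g) = c * pairing D f g.
    by rewrite -[c *: g]addr0 pairing_linr (pairing0 (@pairing_linr K m n)) addr0.
  have comm f : lsubst U^T V^T (lsubst 1%:M 2%:M f) =
      lsubst 1%:M 2%:M (lsubst U^T V^T f).
    by rewrite [LHS]lsubst_comp [RHS]lsubst_comp mulmx1 mul1mx scalar_mxC.
  transitivity (pairing D (lsubst 1%:M 2%:M (xmonom K t))
                          (lsubst U^T V^T (xmonom K t'))).
    by rewrite E [RHS]pairingC ZE; apply: (congr1 ( *%R _)); apply: pairingC.
  transitivity (pairing D (xmonom K t)
                  (lsubst U^T V^T (lsubst 1%:M 2%:M (xmonom K t')))).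
    by rewrite comm [RHS]pairing_lsubst !tr_scalar_mx.
  by rewrite E lsubstZ ZE.
move/eqP; rewrite -subr_eq0 -mulrBl mulf_eq0 subr_eq0 => /orP[/eqP E2|/eqP //].
case/eqP: ntt'; apply: (Num.Theory.ieexprIn _ _ E2); rewrite ?Num.Theory.ltr0n //.
by rewrite Num.Theory.pnatr_eq1.
Qed.

(** The substitution is the diagonal one diag(a r, b s) after diag(U^T, V^T); the
    latter produces the generating function, and the former rescales each of its
    monomials. *)
Lemma lsubst_krawtchouk (a b : K) (r : 'rV[K]_m) (s : 'rV[K]_n) U V d t' :
  t' \in ADd m n D d ->
  lsubst (a *: (diag_mx r *m U^T)) (b *: (diag_mx s *m V^T)) (xmonom K t') =
  (a ^+ (D - d) * b ^+ d * (D`!)%:R) *: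
    \sum_(t in ADd m n D d)
      (super_krawtchouk U V t t' * (smonom (r 0) (s 0) t / (mfact t.1)%:R))
      *: xmonom K t.
Proof.
rewrite [t' \in _]inE => /andP[t'D /eqP t'd].
rewrite !scalemxAl.
have -> : a *: diag_mx r = diag_mx (a *: r) by rewrite linearZ.
have -> : b *: diag_mx s = diag_mx (b *: s) by rewrite linearZ.
rewrite -lsubst_comp -krawtchouk_genE_subst krawtchouk_genE // lsubst_sum.
rewrite (bigID (fun t => #|t.2| == d)) /= [X in _ + X]big1 ?addr0; last first.
  move=> t /andP[tD td]; rewrite super_krawtchouk_parity ?t'd //.
  by rewrite mulr0 scale0r.
rewrite scaler_sumr; apply: eq_big => [t|t /andP[tD /eqP td]].
  by rewrite [RHS]inE.
rewrite lsubst_diag !scalerA; congr (_ *: _).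
have -> : smonom ((a *: r) 0) ((b *: s) 0) t =
    smonom (fun k => a * r 0 k) (fun k => b * s 0 k) t.
  by apply: eq_smonom => k; rewrite mxE.
rewrite smonomM td; have -> : mdeg t.1 = (D - d)%N.
  by move: tD; rewrite inE td => /eqP tD; rewrite -[LHS](addnK d) tD.
move: (a ^+ _ * _) (D`!%:R) (_^-1) (super_krawtchouk _ _ _ _) (smonom _ _ _).
by move=> u v w y z; ring.
Qed.
End Krawtchouk.

(** * The module of degree D and its weight bases *)

Section Module.
Variables (K : numFieldType) (m n D : nat).
Notation SP := (superpoly K m n).
Implicit Types (f g : SP) (R U : 'M[K]_m) (S V : 'M[K]_n) (t : sidx m n D).
Implicit Types (X Y : 'M[K]_(m + n)) (i k : 'I_(m + n)).
Let F := superpoly_fock K m n.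

Lemma gl_actE X f : gl_act X f = glact F X f.
Proof.
by apply: eq_bigr => i _; apply: eq_bigr => j _; apply: congr1; apply: svarM.
Qed.

Lemma graded_lin d c f g : graded d f -> graded d g -> graded d (c *: f + g).
Proof.
by move=> hf hg T b bd; rewrite !ffunE mcoeffD mcoeffZ hf // hg // mulr0 addr0.
Qed.

Lemma graded0 d : graded d (0 : SP).
Proof. by move=> T b _; rewrite ffunE mcoeff0. Qed.

Lemma graded_homog f : homog_part D f <-> graded D f.
Proof.
split=> [[c ->]|fD].
  elim/big_rec: _ => [|t g tD gD]; first exact: graded0.
  apply: graded_lin => // T b bD; rewrite xmonomE [LHS]mcoeff_mono.
  case: eqP => // TE; case: eqP => // bE; case/negP: bD.
  by rewrite -bE TE; move: tD; rewrite inE.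
exists (fun t => (f t.2)@_(t.1)); apply/ffunP => T; apply/mpolyP => b.
rewrite sum_ffunE raddf_sum /=.
under eq_bigr => t _ do rewrite ffunE mcoeffZ xmonomE [X in _ * X]mcoeff_mono.
have [bD|bD] := boolP (mdeg b + #|T| == D)%N; last first.
  rewrite fD // big1 // => t tD.
  case: eqP => [TE|_]; last by rewrite mulr0.
  case: eqP => [bE|_]; last by rewrite mulr0.
  by case/negP: bD; rewrite -bE TE; move: tD; rewrite inE.
rewrite (bigD1 (bidx bD)) ?inE //= !eqxx mulr1 big1 ?addr0 // => t /andP[_ nt].
case: eqP => [tT|_]; last by rewrite mulr0.
case: eqP => [bt|_]; last by rewrite mulr0.
by case/eqP: nt; apply: bidx_eq.
Qed.

Lemma graded_sderiv d k f : graded d.+1 f -> graded d (sderiv k f).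
Proof.
move=> fd T b bd; case: (split_ordP k) => a ->; rewrite ?(sderivl, sderivr) ffunE.
  by rewrite mcoeff_deriv fd ?mul0rn // mdegD mdeg1 addn1 addSn eqSS.
case: ifP => aT; first exact: mcoeff0.
by rewrite sign_scale mcoeffZ fd ?mulr0 // cardsU1 aT /= add1n addnS eqSS.
Qed.

Lemma graded0_sderiv k f : graded 0 f -> sderiv k f = 0.
Proof.
move=> f0; apply/ffunP => T; apply/mpolyP => b.
case: (split_ordP k) => a ->; rewrite ?(sderivl, sderivr) !ffunE mcoeff0.
  by rewrite mcoeff_deriv f0 ?mul0rn // mdegD mdeg1 addn1 addSn.
case: ifP => aT; first exact: mcoeff0.
by rewrite sign_scale mcoeffZ f0 ?mulr0 // cardsU1 aT /= add1n addnS.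
Qed.

Lemma graded_svar k : graded 1 (svar K k : SP).
Proof.
case: (split_ordP k) => a ->; first by rewrite svarl; apply: graded_evar.
by rewrite svarr; apply: graded_ovar.
Qed.

Lemma graded_gl_act X f : graded D f -> graded D (gl_act X f).
Proof.
move=> fD.
have sumP (J : finType) (h : J -> SP) : (forall j, graded D (h j)) ->
    graded D (\sum_j h j).
  move=> hD; elim/big_rec: _ => [|j g _ gD]; first exact: graded0.
  by rewrite -[h j]scale1r; apply: graded_lin.
apply: (sumP) => i; apply: sumP => j; rewrite -[_ *: _]addr0.
apply: graded_lin; last exact: graded0.
case: D fD => [|D'] fD.
  by rewrite graded0_sderiv // mulr0; apply: graded0.
rewrite -[D'.+1]add1n; apply: gradedM; first exact: graded_svar.
exact: graded_sderiv.
Qed.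

Lemma gl_module_homog : gl_module (@homog_part K m n D).
Proof.
split=> [X f|a b X Y hX hY f _].
  by move/graded_homog => fD; apply/graded_homog/graded_gl_act.
rewrite !gl_actE; exact: (glact_bracket F f hX hY).
Qed.

End Module.

Section WeightBasis.
Variables (K : numFieldType) (m n D : nat).
Notation SP := (superpoly K m n).
Implicit Types (f g : SP) (R U : 'M[K]_m) (S V : 'M[K]_n) (t : sidx m n D).
Implicit Types (X Y : 'M[K]_(m + n)) (i k : 'I_(m + n)).

Definition expo t i : nat :=
  match split i with inl a => t.1 a | inr j => (j \in t.2) end.

Lemma gl_act_delta k f : gl_act (delta_mx k k) f = smul k (sderiv k f).
Proof.
rewrite gl_actE glactE (bigD1 k) //= big1 ?addr0 => [|j /negPf jk].
  rewrite /colv (bigD1 k) //= big1 ?addr0 => [|j /negPf jk].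
    by rewrite mxE !eqxx scale1r.
  by rewrite mxE jk scale0r.
by rewrite /colv big1 // => i _; rewrite mxE jk andbF scale0r.
Qed.

Lemma gl_act_delta_xmonom k t :
  gl_act (delta_mx k k) (xmonom K t) = (expo t k)%:R *: xmonom K t.
Proof.
rewrite gl_act_delta xmonomE /expo; apply/ffunP => T.
case: (split_ordP k) => a ->; rewrite ?(unsplitK (inl a)) ?(unsplitK (inr a)).
  rewrite smull sderivl !ffunE; case: eqP => _; last first.
    by rewrite mderiv0 mulr0 scaler0.
  rewrite mderivX -scalerAr; case E : (t.1 a) => [|d]; first by rewrite !scale0r.
  rewrite -mpolyXD addmC submK //; apply/mnm_lepP => c.
  by rewrite mnm1E; case: eqP => // <-; rewrite E.
rewrite smulr sderivr !ffunE; case: ifP => [aT|aT].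
  rewrite setD11 setD1K // mulrA -expr2 sqrr_sign mul1r.
  by case: eqP => [<-|_]; rewrite ?aT ?scale1r ?scaler0.
by case: eqP => [<-|_]; rewrite ?aT ?scale0r ?scaler0.
Qed.

(** The weight of w^t for the Cartan subalgebra conjugated by G, where H is the
    inverse of G: conjugate back and read the weight off the diagonal. *)
Definition gdiag_form (G H : 'M[K]_(m + n)) t X : K :=
  \sum_i (H *m X *m G) i i * (expo t i)%:R.

Lemma gdiag_form_is_linear G H t : linear_for *%R (gdiag_form G H t).
Proof.
move=> c X Y; rewrite /gdiag_form mulr_sumr -big_split; apply: eq_bigr => i _ /=.
rewrite mulmxDr mulmxDl -scalemxAr -scalemxAl [in LHS]mxE [in LHS]mxE.
by rewrite mulrDl mulrA.
Qed.
HB.instance Definition _ G H t := GRing.isLinear.Build K 'M[K]_(m + n) K *%R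
  (gdiag_form G H t) (gdiag_form_is_linear G H t).

Lemma gl_act_linl f c X Y : gl_act (c *: X + Y) f = c *: gl_act X f + gl_act Y f.
Proof.
rewrite /gl_act scaler_sumr -big_split; apply: eq_bigr => i _ /=.
rewrite scaler_sumr -big_split; apply: eq_bigr => j _ /=.
by rewrite !mxE scalerDl scalerA.
Qed.

Lemma span_ind (vT : vectType K) (s : seq vT) (P : vT -> Prop) :
  P 0 -> (forall c u v, P u -> P v -> P (c *: u + v)) ->
  {in s, forall u, P u} -> forall v, v \in <<s>>%VS -> P v.
Proof.
move=> P0 Plin Ps v /(coord_span (X := in_tuple s)) ->.
elim/big_rec: _ => [|i u _ Pu] //; apply: Plin => //.
by apply: Ps; apply: mem_nth.
Qed.

Section Basis.
Variables (R : 'M[K]_m) (S : 'M[K]_n).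
Hypotheses (uR : R \in unitmx) (uS : S \in unitmx).

Lemma lsubstK : cancel (lsubst R S) (lsubst (invmx R) (invmx S)).
Proof. by move=> f; rewrite lsubst_comp !mulVmx // lsubst1. Qed.

Lemma lsubstVK : cancel (lsubst (invmx R) (invmx S)) (lsubst R S).
Proof. by move=> f; rewrite lsubst_comp !mulmxV // lsubst1. Qed.

Lemma lsubst_gl_act X f :
  gl_act (gl_conj R S X) (lsubst R S f) = lsubst R S (gl_act X f).
Proof.
rewrite !gl_actE; apply: glact_conj.
- exact: supported_subst_mx.
- exact: is_subst_lsubst.
- by rewrite [LHS]subst_mxM !mulVmx // subst_mx1.
Qed.

Lemma lsubst_xmonom_homog R' S' t : t \in AD m n D ->
  homog_part D (lsubst R' S' (xmonom K t)).
Proof.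
move=> tD; rewrite -[R']trmxK -[S']trmxK -krawtchouk_genE_subst.
by rewrite krawtchouk_genE //; eexists.
Qed.

Lemma lsubst_homog R' S' f : homog_part D f -> homog_part D (lsubst R' S' f).
Proof.
case=> c ->; rewrite lsubst_sum; apply/graded_homog.
elim/big_rec: _ => [|t g tD gD]; first exact: graded0.
apply: graded_lin => //; apply/graded_homog; exact: lsubst_xmonom_homog.
Qed.

Lemma lsubst0 R' S' : lsubst R' S' (0 : SP) = 0.
Proof. by rewrite -[X in lsubst _ _ X](scale0r 0) lsubstZ scale0r. Qed.

Lemma xmonom_neq0 t : xmonom K t != 0.
Proof.
rewrite xmonomE; apply/eqP => /(congr1 (fun f : SP => (f t.2)@_(t.1))).
rewrite [LHS]mcoeff_mono !eqxx ffunE mcoeff0.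
by move/eqP; rewrite oner_eq0.
Qed.

Lemma xmonom_free (c : sidx m n D -> K) :
  \sum_(t in AD m n D) c t *: xmonom K t = 0 ->
  forall t, t \in AD m n D -> c t = 0.
Proof.
move=> c0 t tD.
have cE t' : ((c t' *: xmonom K t' : SP) t.2)@_(t.1) =
    c t' * ((t.2 == t'.2) && (t'.1 == t.1 :> 'X_{1..m}))%:R.
  by rewrite xmonomE ffunE mcoeffZ [X in _ * X]mcoeff_mono.
have := congr1 (fun f : SP => (f t.2)@_(t.1)) c0.
rewrite sum_ffunE raddf_sum /= (bigD1 t) //= big1 ?addr0 => [|t' /andP[_ nt]].
  by rewrite cE !eqxx mulr1 ffunE mcoeff0.
rewrite cE; case: eqP => [E2|_]; last by rewrite mulr0.
case: eqP => [E1|_]; last by rewrite mulr0.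
case/eqP: nt; rewrite [t]surjective_pairing [t']surjective_pairing E2.
by congr (_, _); apply: val_inj.
Qed.

(** The substitution is an automorphism of the degree D part that carries the
    action of the diagonal matrices to that of their conjugates. *)
Lemma lsubst_weight_basis :
  weight_basis (tcartan R S) (@homog_part K m n D) (AD m n D)
    (fun t => lsubst R S (xmonom K t)).
Proof.
split; first split.
- by move=> t; apply: lsubst_xmonom_homog.
- move=> f /(lsubst_homog (invmx R) (invmx S)) [c fE]; exists c.
  by rewrite -lsubst_sum -fE lsubstVK.
- move=> c; rewrite -lsubst_sum => c0; apply: xmonom_free.
  by rewrite -[LHS]lsubstK c0 lsubst0.
move=> t tD; split.
  apply/eqP => t0; case/eqP: (xmonom_neq0 t).
  by rewrite -[LHS]lsubstK t0 lsubst0.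
exists (gdiag_form (subst_mx R S) (subst_mx (invmx R) (invmx S)) t) => X.
have HG : subst_mx (invmx R) (invmx S) *m subst_mx R S = 1%:M.
  by rewrite subst_mxM !mulVmx // subst_mx1.
have act0 f : gl_act 0 f = 0.
  have := gl_act_linl f (- 1) 0 0.
  by rewrite scaler0 addr0 scaleN1r addNr.
move: X; apply: span_ind => [|c X Y IHX IHY|X /mapP[k _ ->]].
- by rewrite act0 linear0 scale0r.
- by rewrite gl_act_linl IHX IHY linearP scalerDl scalerA.
rewrite lsubst_gl_act gl_act_delta_xmonom lsubstZ; congr (_ *: _).
rewrite /= /gdiag_form /gl_conj !mulmxA HG mul1mx -!mulmxA HG mulmx1.
rewrite (bigD1 k) //= big1 ?addr0 => [|i /negPf ik].
  by rewrite mxE !eqxx mul1r.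
by rewrite mxE ik mul0r.
Qed.
End Basis.

Lemma gl_conj1 X : gl_conj 1%:M 1%:M X = X.
Proof.
by rewrite /gl_conj !invmx1 -scalar_mx_block mulmx1 mul1mx.
Qed.

Lemma tcartan1 : tcartan 1%:M 1%:M = cartan :> {vspace 'M[K]_(m + n)}.
Proof. by congr (span _); apply: eq_map => i; rewrite gl_conj1. Qed.

Lemma eq_weight_basis (T : finType) (H : {vspace 'M[K]_(m + n)}) W
    (I : {set T}) (b b' : T -> SP) : b =1 b' ->
  weight_basis H W I b -> weight_basis H W I b'.
Proof.
move=> bb' [[Wb gen free] wt]; split; last by move=> t /wt; rewrite bb'.
split=> [t /Wb|f /gen[c ->]|c]; first by rewrite bb'.
  by exists c; apply: eq_bigr => t _; rewrite bb'.
by move=> c0; apply: free; rewrite -[RHS]c0; apply: eq_bigr => t _; rewrite bb'.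
Qed.

Lemma txmonomE (pt : 'rV[K]_m) U (qt : 'rV[K]_n) V (a b : K) t :
  txmonom pt U qt V a b t =
  lsubst (a *: (diag_mx pt *m U^T)) (b *: (diag_mx qt *m V^T)) (xmonom K t).
Proof.
rewrite lsubst_xmonom; apply: eq_smonom => k; rewrite scaler_sumr;
  by apply: eq_bigr => i _; rewrite scalerA mxE mul_diag_mx !mxE.
Qed.
End WeightBasis.

Lemma krawtchouk_inv (K : fieldType) (N : nat) (p pt : 'rV[K]_N.+1) U (a : K) :
  krawtchouk_data p pt U -> a != 0 ->
  (a *: (diag_mx pt *m U^T)) *m ((p 0 0 * a)^-1 *: (diag_mx p *m U)) = 1%:M.
Proof.
case=> _ p0 _ _ PU a0; apply: mulmx1C.
rewrite -scalemxAl -scalemxAr scalerA mulmxA PU scale_scalar_mx.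
by rewrite -mulrA [a * _]mulrC mulVf ?mulf_neq0.
Qed.

Theorem theorem4p2 (R : realType) (m n D : nat)
    (p pt : 'rV[R[i]]_m.+1) (U : 'M[R[i]]_m.+1)
    (q qt : 'rV[R[i]]_n.+1) (V : 'M[R[i]]_n.+1)
    (thetat kappat : R[i])
    (hK : krawtchouk_data p pt U) (hL : krawtchouk_data q qt V)
    (hR : \det (thetat *: (diag_mx pt *m U^T)) = 1)
    (hS : \det (kappat *: (diag_mx qt *m V^T)) = 1) :
  [/\ gl_module (@homog_part R[i] m.+1 n.+1 D),
      weight_basis cartan (@homog_part R[i] m.+1 n.+1 D)
        (AD m.+1 n.+1 D) (@xmonom R[i] m.+1 n.+1 D),
      weight_basis
        (tcartan (thetat *: (diag_mx pt *m U^T))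
                 (kappat *: (diag_mx qt *m V^T)))
        (@homog_part R[i] m.+1 n.+1 D)
        (AD m.+1 n.+1 D) (txmonom pt U qt V thetat kappat),
      forall (d : nat) (t' : sidx m.+1 n.+1 D), t' \in ADd m.+1 n.+1 D d ->
        txmonom pt U qt V thetat kappat t' =
        (thetat ^+ (D - d) * kappat ^+ d * (D`!)%:R) *:
          \sum_(t in ADd m.+1 n.+1 D d)
            (super_krawtchouk U V t t'
             * (smonom (pt 0) (qt 0) t / (mfact t.1)%:R))
            *: xmonom R[i] t &
      forall (d : nat) (t : sidx m.+1 n.+1 D), t \in ADd m.+1 n.+1 D d ->
        xmonom R[i] t =
        ((p 0 0 * thetat)^-1 ^+ (D - d) * (q 0 0 * kappat)^-1 ^+ d
         * (D`!)%:R) *: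
          \sum_(t' in ADd m.+1 n.+1 D d)
            (super_krawtchouk U V t t'
             * (smonom (p 0) (q 0) t' / (mfact t'.1)%:R))
            *: txmonom pt U qt V thetat kappat t'].
Proof.
have nz (N : nat) (c : R[i]) (A : 'M[R[i]]_N.+1) : \det (c *: A) = 1 -> c != 0.
  by apply: contra_eq_neq => ->; rewrite detZ expr0n mul0r eq_sym oner_neq0.
have un (N : nat) (A : 'M[R[i]]_N.+1) : \det A = 1 -> A \in unitmx.
  by rewrite unitmxE => ->; apply: unitr1.
split.
- exact: gl_module_homog.
-
  (* The Cartan subalgebra is its own conjugate by R = 1, S = 1. *)
  rewrite -tcartan1; apply: eq_weight_basis (fun t => lsubst1 (xmonom R[i] t)) _.
  exact: (lsubst_weight_basis D (unitmx1 _ _) (unitmx1 _ _)).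
- apply: eq_weight_basis (fun t => esym (txmonomE pt U qt V thetat kappat t)) _.
  exact: (lsubst_weight_basis D (un _ _ hR) (un _ _ hS)).
- by move=> d t' t'd; rewrite txmonomE; apply: lsubst_krawtchouk.
move=> d t td.
have RV := krawtchouk_inv hK (nz _ _ _ hR).
have SV := krawtchouk_inv hL (nz _ _ _ hS).
(* The inner substitution is the inverse one, written with U^T and V^T in the
   roles of U and V. *)
transitivity (lsubst
  (thetat *: (diag_mx pt *m U^T)) (kappat *: (diag_mx qt *m V^T))
  (lsubst ((p 0 0 * thetat)^-1 *: (diag_mx p *m U^T^T))
          ((q 0 0 * kappat)^-1 *: (diag_mx q *m V^T^T)) (xmonom R[i] t))).
  by rewrite lsubst_comp !trmxK RV SV lsubst1.
rewrite (lsubst_krawtchouk _ _ _ _ _ _ td) lsubstZ lsubst_sum.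
apply: congr1; apply: eq_bigr => t' t'd; rewrite txmonomE.
have [tD t'D] : t \in AD m.+1 n.+1 D /\ t' \in AD m.+1 n.+1 D.
  move: td t'd; rewrite [t \in ADd _ _ _ _]inE [t' \in ADd _ _ _ _]inE.
  by move=> /andP[-> _] /andP[-> _].
by rewrite (super_krawtchouk_tr U V tD t'D).
Qed.
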